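(* Let $X$ be a Banach lattice on $\mathbb{T}=[0,2\pi)$ endowed with the Lebesgue measure. Assume that there exists $C>0$ such that for all $n$ $$\|S_nf\|_X\le C\|f\|_X,\qquad f\in X,$$ where $S_n$ is the $n$-th Fourier partial sum operator. Then, for all $T_n\in\mathcal{T}_n$, we have $$\|T_n\|_X\asymp\bigg\|\sum_{k=0}^{2n}|T_n(t_k)|\chi_{[t_k,t_{k+1}]}\bigg\|_X,\qquad t_k=\frac{2\pi k}{2n+1},$$ with equivalence constants independent of $n$ and $T_n$.
   Context: A Banach (function) lattice $X=X(\mathbb{T},\mu)$ (here $d\mu(x)=dx$) is a Banach space of functions on $\mathbb{T}$ with a functional $\|\cdot\|_X$ such that: 1) $\|f\|_X=0$ iff $f=0$; 2) $\|\lambda f\|_X=|\lambda|\|f\|_X$ for $\lambda\in\mathbb{C}$; 3) $\|f+g\|_X\le\|f\|_X+\|g\|_X$; 4) if $|f|\le|g|$ then $\|f\|_X\le\|g\|_X$ for $f,g\in X$; 5) $\chi_B\in X$ for all $B$ with $\mu(B)<\infty$; moreover $X\subset L_1$ is assumed. $\mathcal{T}_n$ is the set of trigonometric polynomials $T(x)=\sum_{k=-n}^nc_ke^{ikx}$ of degree at most $n$. $S_nf(x)=\sum_{|k|\le n}\widehat f(k)e^{ikx}$. $A\asymp B$ means that $C'^{-1}B\le A\le C'B$ with a positive constant $C'$ independent of the essential variables. *)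

(* Defs.v *)
From mathcomp Require Import all_boot all_order all_algebra.
From mathcomp Require Import complex.
From mathcomp Require Import all_classical all_reals all_analysis.
Set Implicit Arguments.
Unset Strict Implicit.
Unset Printing Implicit Defensive.
Import Order.TTheory GRing.Theory Num.Theory.
Import numFieldNormedType.Exports.
Local Open Scope classical_set_scope.
Local Open Scope ring_scope.
Local Open Scope complex_scope.

(* A function on the torus is a total function R -> R[i] of which only the
   restriction to [0, 2 pi[ matters, up to lebesgue_measure-null sets. *)
Definition torus (R : realType) : set R := `[0, 2 * pi[%classic.
Arguments torus : clear implicits.

Definition ae_torus (R : realType) (P : R -> Prop) : Prop :=
  {ae @lebesgue_measure R, forall x, torus R x -> P x}.

Definition cmeasurable (R : realType) (f : R -> R[i]) : Prop :=
  measurable_fun (torus R) (fun x => complex.Re (f x)) /\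
  measurable_fun (torus R) (fun x => complex.Im (f x)).

Definition cintegrable (R : realType) (f : R -> R[i]) : Prop :=
  (@lebesgue_measure R).-integrable (torus R)
    (fun x => (complex.Re (f x))%:E) /\
  (@lebesgue_measure R).-integrable (torus R)
    (fun x => (complex.Im (f x))%:E).

Definition cintegral (R : realType) (f : R -> R[i]) : R[i] :=
  (\int[@lebesgue_measure R]_(x in torus R) complex.Re (f x)) +i*
  (\int[@lebesgue_measure R]_(x in torus R) complex.Im (f x)).

Definition cindic (R : realType) (B : set R) : R -> R[i] :=
  fun x => (\1_B x)%:C.

(* [bl_mem] is the set of (representatives of) elements of X; [bl_norm] is
   meaningful only on it.  Measurability is Borel measurability, and
   lebesgue_measure is not complete on Borel sets, so saturation under a.e.
   equality ([bl_ae]) has to be restricted to measurable functions.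
   Solidity (g in X and |f| <= |g| imply f in X) is not required. *)
Record banach_lattice (R : realType) := BanachLattice {
  bl_mem : set (R -> R[i]) ;
  bl_norm : (R -> R[i]) -> R ;
  bl_L1 : forall f, bl_mem f -> cintegrable f ;
  bl_ae : forall f g, bl_mem f -> cmeasurable g ->
    ae_torus (fun x => f x = g x) -> bl_mem g ;
  bl_add : forall f g, bl_mem f -> bl_mem g -> bl_mem (fun x => f x + g x) ;
  bl_scale : forall (l : R[i]) f, bl_mem f -> bl_mem (fun x => l * f x) ;
  bl_indic : forall B : set R, measurable B -> B `<=` torus R ->
    bl_mem (cindic B) ;
  bl_norm_eq0 : forall f, bl_mem f ->
    bl_norm f = 0 <-> ae_torus (fun x => f x = 0) ;
  bl_normZ : forall (l : R[i]) f, bl_mem f ->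
    bl_norm (fun x => l * f x) = ComplexField.Normc.normc l * bl_norm f ;
  bl_normD : forall f g, bl_mem f -> bl_mem g ->
    bl_norm (fun x => f x + g x) <= bl_norm f + bl_norm g ;
  bl_norm_le : forall f g, bl_mem f -> bl_mem g ->
    ae_torus (fun x => `|f x| <= `|g x|) -> bl_norm f <= bl_norm g ;
  bl_complete : forall u : nat -> R -> R[i], (forall m, bl_mem (u m)) ->
    (forall e : R, 0 < e -> exists N : nat, forall p q : nat,
      (N <= p)%N -> (N <= q)%N -> bl_norm (fun x => u p x - u q x) < e) ->
    exists2 f, bl_mem f &
      (fun m => bl_norm (fun x => u m x - f x)) @ \oo --> (0 : R)
}.

Definition expi (R : realType) (x : R) : R[i] := cos x +i* sin x.

(* sum_{k = -n}^{n} c_k e^{ikx}, indexed by j = k + n *)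
Definition trig_sum (R : realType) (n : nat) (c : int -> R[i]) (x : R) : R[i] :=
  \sum_(j < (2 * n).+1)
    c (j%:Z - n%:Z) * expi ((j%:Z - n%:Z)%:~R * x).

Definition trig_poly (R : realType) (n : nat) (T : R -> R[i]) : Prop :=
  exists c : int -> R[i], forall x, T x = trig_sum n c x.

Definition fourier_coef (R : realType) (f : R -> R[i]) (k : int) : R[i] :=
  ((2 * pi)^-1 : R)%:C * cintegral (fun x => f x * expi (- (k%:~R * x))).

Definition fourier_sum (R : realType) (n : nat) (f : R -> R[i]) : R -> R[i] :=
  trig_sum n (fourier_coef f).

Definition node (R : realType) (n k : nat) : R :=
  2 * pi * k%:R / (2 * n + 1)%:R.

Definition step_abs (R : realType) (n : nat) (T : R -> R[i]) : R -> R[i] :=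
  fun x => \sum_(k < (2 * n).+1)
    `|T (node R n k)| * cindic `[node R n k, node R n k.+1]%classic x.

(* Main.v *)
(** Write [N = 2n+1], [z = e^{i(x-y)}] and [G_m(z) = sum_{j<m} z^j].  Since
    [|G_m|^2 = sum_{l<m} D_l] with [D_l] the Dirichlet kernels, the bound on the
    [S_l] makes convolution with a suitable average [M] of the [|G_m|^2], [m] of
    order [N], bounded on [X].  This [M] is positive and dominates
    [c min(N, 1 / (N |z-1|^2))], so convolution with it absorbs every absolutely
    summable error at scale [1/N].

    Samples by polynomial: [T] is reproduced by a de la Vallee Poussin kernel,
    which, moved from [t_k] to any [x] of the same cell, is dominated by [M];
    hence [|T(t_k)| <= c (M * |T|)(x)].

    Polynomial by samples: by interpolation [2 pi T(x)] is the integral over [y]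
    of [T(t_k) D_n(x - t_k)], [t_k] being the node of the cell of [y].  With
    [s = e^{i(x - t_k)}], [D_n = (s^{n+1} - s^{-n}) / (s - 1)]; replacing
    [1 / (s - 1)] by minus the Cesaro mean of the one-sided sums [G_m(z)] costs an
    error [O(M)].  What is left are convolutions with that mean, bounded on [X]
    because the one-sided sums are modulated partial sums; the factors [s^{n+1}]
    and [s^{-n}] only modulate the input and the output, which a lattice norm does
    not see. *)
Require Import Defs.
From mathcomp Require Import all_boot all_order all_algebra.
From mathcomp Require Import complex.
From mathcomp Require Import all_classical all_reals all_analysis.
From mathcomp Require Import measurable_realfun zify ring lra.
Set Implicit Arguments.
Unset Strict Implicit.
Unset Printing Implicit Defensive.
Import Order.TTheory GRing.Theory Num.Theory.
Import numFieldNormedType.Exports.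
Import ComplexField.Normc.
Local Open Scope classical_set_scope.
Local Open Scope ring_scope.
Local Open Scope complex_scope.

(** * The modulus of a complex number as a real-valued function *)

Section ComplexModulus.
Variable R : realType.
Implicit Types (z w : R[i]) (x y : R).

Lemma normr_normc z : `|z| = (normc z)%:C.
Proof. by case: z. Qed.

Lemma real_complexB x y : (x - y)%:C = x%:C - y%:C :> R[i].
Proof. exact: rmorphB. Qed.

Lemma normc_ge0 z : 0 <= normc z.
Proof. by case: z => a b /=; exact: sqrtr_ge0. Qed.

Lemma normc_real x : normc x%:C = `|x|.
Proof. by rewrite /= expr0n /= addr0 sqrtr_sqr. Qed.

Lemma normc_conj z : normc z^* = normc z.
Proof. by case: z => a b /=; rewrite sqrrN. Qed.

Lemma le_normcB z w : normc (z - w) <= normc z + normc w.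
Proof. by rewrite -(normcN w); exact: le_normcD. Qed.

Lemma normcB z w : normc (z - w) = normc (w - z).
Proof. by rewrite -normcN opprB. Qed.

Lemma normc_exp z n : normc (z ^+ n) = normc z ^+ n.
Proof. by elim: n => [|n IH]; rewrite ?expr0 ?normc1 // !exprS normcM IH. Qed.

Lemma normc_sum (I : Type) (r : seq I) (P : pred I) (F : I -> R[i]) :
  normc (\sum_(i <- r | P i) F i) <= \sum_(i <- r | P i) normc (F i).
Proof.
elim/big_rec2: _ => [|i a b _ le_ba]; first by rewrite normc0.
by apply: (le_trans (le_normcD _ _)); rewrite lerD2l.
Qed.

Lemma Re_le_normc z : complex.Re z <= normc z.
Proof.
case: z => a b /=; apply: (le_trans (ler_norm _)).
by rewrite -sqrtr_sqr ler_wsqrtr // lerDl sqr_ge0.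
Qed.

Lemma normc_le_Re_Im z : normc z <= `|complex.Re z| + `|complex.Im z|.
Proof.
case: z => a b /=; rewrite -(ger0_norm (addr_ge0 (normr_ge0 a) (normr_ge0 b))).
rewrite -sqrtr_sqr ler_wsqrtr // sqrrD !real_normK ?num_real //.
by rewrite addrAC lerDl mulrn_wge0 // mulr_ge0.
Qed.

Lemma mulr_conj_normc z : z * z^* = ((normc z) ^+ 2)%:C.
Proof. by rewrite -sqr_normc normr_normc rmorphXn. Qed.

Lemma normc_gt0 z : (0 < normc z) = (z != 0).
Proof.
rewrite lt_neqAle normc_ge0 andbT eq_sym; apply/idP/idP.
  by apply: contra_neq => ->; rewrite normc0.
by apply: contra_neq => /eq0_normc.
Qed.

End ComplexModulus.

(** * The character [x |-> e^{ix}] *)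

Section Expi.
Variable R : realType.
Implicit Types x y : R.

Lemma expi0 : expi 0 = 1 :> R[i].
Proof. by rewrite /expi cos0 sin0. Qed.

Lemma expiD x y : expi (x + y) = expi x * expi y.
Proof.
rewrite /expi cosD sinD; simpc; congr (_ +i* _).
by rewrite addrC [sin x * _]mulrC.
Qed.

Lemma normc_expi x : normc (expi x) = 1.
Proof. by rewrite /= cos2Dsin2 sqrtr1. Qed.

Lemma expi_neq0 x : expi x != 0.
Proof. by rewrite -normc_gt0 normc_expi. Qed.

Lemma expiN x : expi (- x) = (expi x)^-1.
Proof.
apply: (mulfI (expi_neq0 x)).
by rewrite -expiD subrr expi0 divff // expi_neq0.
Qed.

Lemma expi_nat n x : expi (n%:R * x) = expi x ^+ n.
Proof.
elim: n => [|n IH]; first by rewrite mul0r expi0.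
by rewrite -addn1 natrD mulrDl mul1r expiD IH addn1 exprSr.
Qed.

Lemma expi_intB (j n : nat) x :
  expi ((j%:Z - n%:Z)%:~R * x) = expi x ^+ j / expi x ^+ n.
Proof.
by rewrite rmorphB /= mulrBl expiD expiN -!pmulrn !expi_nat.
Qed.

Lemma expi_2pi : expi (2 * pi) = 1 :> R[i].
Proof. by rewrite /expi mulrC mulr_natr cos2pi sin2pi. Qed.

(** Mean value theorem applied to cosine and sine separately; adding the two bounds costs a factor 2
    over the sharp constant, which is harmless later. *)
Lemma expi_lip x y : normc (expi x - expi y) <= 2 * `|x - y|.
Proof.
have lip (f df : R -> R) : (forall t : R, is_derive t 1 f (df t)) ->
    (forall t, `|df t| <= 1) -> `|f x - f y| <= `|x - y|.
  move=> fE dfle; wlog xy : x y / y <= x.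
    by move=> H; case: (leP y x) => [|/ltW] /H //; rewrite distrC (distrC y).
  have [|c _ ->] := @MVT_segment _ f df y x xy (fun t _ => fE t).
    by apply: derivable_within_continuous => t _; exact: ex_derive.
  by rewrite normrM ler_piMl.
apply: (le_trans (normc_le_Re_Im _)); rewrite mulrDl mul1r /=; apply: lerD.
- apply: (lip _ (fun t => - sin t)) => t.
  by rewrite normrN ler_norml sin_geN1 sin_le1.
- apply: (lip _ cos) => t.
  by rewrite ler_norml cos_geN1 cos_le1.
Qed.

(** Half-angle formula: [cos x = 1 - 2 sin^2 (x/2)], and [sin (x/2) > 0] because [x/2] lies strictly
    between 0 and [pi]. *)
Lemma expi_nontrivial x : 0 < x < 2 * pi -> expi x != 1.
Proof.
move=> /andP[x0 x2]; apply/eqP => -[cx sx].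
have sh : 0 < sin (x / 2) by apply: sin_gt0_pi; lra.
have : cos x = 1 - 2 * sin (x / 2) ^+ 2.
  have -> : cos x = cos (x / 2 + x / 2) by congr cos; lra.
  by rewrite cosD -!expr2 cos2sin2; lra.
by rewrite cx => /eqP; nra.
Qed.

End Expi.

(** * Algebra of one-sided geometric sums and Dirichlet kernels *)

Section GeometricSums.
Variable F : fieldType.
Implicit Type z : F.

Definition geo (m : nat) z : F := \sum_(j < m) z ^+ j.

Lemma geoS m z : geo m.+1 z = geo m z + z ^+ m.
Proof. by rewrite /geo big_ord_recr. Qed.

Lemma geoSl m z : geo m.+1 z = 1 + z * geo m z.
Proof.
rewrite /geo big_ord_recl expr0 mulr_sumr; congr (_ + _).
by apply: eq_bigr => j _; rewrite exprS.
Qed.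

Lemma geo_telescope m z : (z - 1) * geo m z = z ^+ m - 1.
Proof. by rewrite subrX1. Qed.

Lemma geoD m p z : geo (m + p) z = geo m z + z ^+ m * geo p z.
Proof.
elim: p => [|p IH]; first by rewrite addn0 /geo big_ord0 mulr0 addr0.
by rewrite addnS !geoS IH mulrDr -exprD addrA.
Qed.

Lemma geoV m z : z != 0 -> z ^+ m * geo m z^-1 = z * geo m z.
Proof.
move=> z0; elim: m => [|m IH]; first by rewrite /geo !big_ord0 !mulr0.
rewrite geoS mulrDr exprVn exprS -mulrA IH -mulrA divff ?expf_neq0 //.
by rewrite -mulrDr addrC -geoSl.
Qed.

(** For nonzero [z] this is the symmetric sum of [z^k] over [|k| <= l], arranged to use natural
    exponents only. *)
Definition dirichlet (l : nat) z : F := geo (2 * l).+1 z / z ^+ l.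

(** On the unit circle the left side is [|G_m|^2], so this writes the unnormalised Fejer kernel as a
    sum of Dirichlet kernels. In the induction step, [D_m] is split into negative powers, 1 and
    positive powers, which are exactly the cross terms of the enlarged product. *)
Lemma geo_sqr m z : z != 0 ->
  geo m z * geo m z^-1 = \sum_(l < m) dirichlet l z.
Proof.
move=> z0; elim: m => [|m IH]; first by rewrite /geo !big_ord0 mul0r.
rewrite big_ord_recr -IH /= /dirichlet.
have zm : z ^+ m != 0 by rewrite expf_neq0.
have -> : (2 * m).+1 = (m + m.+1)%N by rewrite mul2n -addnn addnS.
rewrite geoD [in RHS]geoSl -[in RHS]geoV // !geoS exprVn.
move: (z ^+ m) (geo m z) (geo m z^-1) zm => a b c a0.
by field.
Qed.

Definition cesaro_geo (N : nat) z : F := N%:R^-1 * \sum_(m < N) geo m.+1 z.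

(* [cesaro_geo N z] is a bounded stand-in for the singular kernel
   [- (z - 1)^-1]; the identity exhibits the error. *)
Lemma cesaro_geo_telescope N z : N%:R != 0 :> F ->
  (z - 1) * cesaro_geo N z = N%:R^-1 * (z * geo N z) - 1.
Proof.
move=> N0; rewrite /cesaro_geo mulrCA mulr_sumr.
under eq_bigr do rewrite geo_telescope.
rewrite sumrB sumr_const card_ord mulrBr mulVf //; congr (_ * _ - _).
by rewrite mulr_sumr; apply: eq_bigr => j _; rewrite exprS.
Qed.

End GeometricSums.

(** * Pointwise bounds for the kernels on the unit circle *)

Section KernelEstimates.
Variable R : realType.
Implicit Types (z w : R[i]).

Lemma normc_geo_le m z : normc z = 1 -> normc (geo m z) <= m%:R.
Proof.
move=> z1; apply: (le_trans (normc_sum _ _ _)).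
under eq_bigr do rewrite normc_exp z1 expr1n.
by rewrite sumr_const card_ord.
Qed.

Lemma normc_geo_telescope m z : normc z = 1 ->
  normc (z - 1) * normc (geo m z) <= 2.
Proof.
move=> z1; rewrite -normcM geo_telescope.
by apply: (le_trans (le_normcB _ _)); rewrite normc_exp z1 expr1n normc1.
Qed.

Lemma sqr_normc_geo m z : normc z = 1 ->
  ((normc (geo m z)) ^+ 2)%:C = \sum_(l < m) dirichlet l z.
Proof.
move=> z1; have z0 : z != 0 by rewrite -normc_gt0 z1.
rewrite -geo_sqr // -mulr_conj_normc; congr (_ * _).
have -> : z^-1 = z^*.
  by apply: (mulfI z0); rewrite divff // mulr_conj_normc z1 expr1n.
by rewrite /geo rmorph_sum; apply: eq_bigr => j _; rewrite rmorphXn.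
Qed.

(* A positive combination of Fejer kernels; the averaging over [m] removes the
   zeros of the individual kernels. *)
Definition majorant (N : nat) z : R :=
  (N%:R * normc (geo N z) ^+ 2 +
   \sum_(m < 8 * N) normc (geo m.+1 z) ^+ 2) / N%:R ^+ 2.

Lemma majorant_ge0 N z : 0 <= majorant N z.
Proof.
apply: divr_ge0; last exact: sqr_ge0.
apply: addr_ge0; first by rewrite mulr_ge0 ?sqr_ge0.
by apply: sumr_ge0 => m _; exact: sqr_ge0.
Qed.

Lemma normc_expB1_le j z : normc z = 1 -> normc (z ^+ j - 1) <= j%:R * normc (z - 1).
Proof.
move=> z1; rewrite -geo_telescope normcM mulrC ler_wpM2r ?normc_ge0 //.
exact: normc_geo_le.
Qed.

(** Each of the [N] terms is within 1/2 of 1, so there is no cancellation. *)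
Lemma normc_geo_near N z : normc z = 1 -> N%:R * normc (z - 1) <= 2^-1 ->
  N%:R / 2 <= normc (geo N z).
Proof.
move=> z1 near.
have : normc (N%:R - geo N z) <= N%:R / 2.
  have -> : N%:R - geo N z = \sum_(j < N) (1 - z ^+ j).
    by rewrite sumrB sumr_const card_ord.
  apply: (le_trans (normc_sum _ _ _)).
  rewrite mulrC mulr_natr -[X in _ *+ X]card_ord -sumr_const; apply: ler_sum => j _.
  rewrite normcB (le_trans (normc_expB1_le j z1)) // (le_trans _ near) //.
  by rewrite ler_wpM2r ?normc_ge0 // ler_nat ltnW.
have : N%:R <= normc (N%:R - geo N z) + normc (geo N z).
  have := le_normcD (N%:R - geo N z) (geo N z).
  by rewrite subrK -[N%:R](rmorph_nat (real_complex R)) normc_real ger0_norm.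
lra.
Qed.

(** The summand [N |G_N|^2] alone suffices: [|G_N| >= N/2] makes its share at least
    [N (N/2)^2 / N^2]. *)
Lemma majorant_near N z : normc z = 1 -> (0 < N)%N ->
  N%:R * normc (z - 1) <= 2^-1 -> N%:R / 4 <= majorant N z.
Proof.
move=> z1 N0 near; rewrite /majorant ler_pdivlMr ?exprn_gt0 ?ltr0n //.
have := normc_geo_near z1 near.
have s0 : 0 <= \sum_(m < 8 * N) normc (geo m.+1 z) ^+ 2.
  by apply: sumr_ge0 => m _; exact: sqr_ge0.
have Np : 0 < N%:R :> R by rewrite ltr0n.
set g := normc (geo N z) => gN.
have g0 : 0 <= g := normc_ge0 _.
have : (N%:R / 2) ^+ 2 <= g ^+ 2 by rewrite ler_pXn2r ?nnegrE //; lra.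
nra.
Qed.

(** Here [|z-1|^2 |G_m|^2 = |z^m - 1|^2 = 2 - 2 Re z^m]. Over [8N] values of [m] the constants add
    up to [16N], while the oscillating part is at most [4 / |z-1| <= 8N]; at least [8N] survives,
    whatever the zeros of the single kernels. *)
Lemma majorant_far N z : normc z = 1 -> (0 < N)%N ->
  2^-1 <= N%:R * normc (z - 1) -> 8 <= N%:R * normc (z - 1) ^+ 2 * majorant N z.
Proof.
move=> z1 N0 far.
have Np : 0 < N%:R :> R by rewrite ltr0n.
set w := normc (z - 1) in far *.
have w0 : 0 < w by nra.
have sumE : \sum_(m < 8 * N) (w * normc (geo m.+1 z)) ^+ 2 =
    16 * N%:R - 2 * complex.Re (z * geo (8 * N) z).
  rewrite (_ : z * geo (8 * N) z = \sum_(m < 8 * N) z ^+ m.+1); last first.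
    by rewrite mulr_sumr; apply: eq_bigr => j _; rewrite exprS.
  rewrite (_ : complex.Re _ = \sum_(m < 8 * N) complex.Re (z ^+ m.+1)); last first.
    by elim/big_rec2: _ => // i a b _ <-; case: (z ^+ _) b => [? ?] [? ?].
  have -> : 16 * N%:R = \sum_(m < 8 * N) (2 : R).
    by rewrite sumr_const card_ord -[RHS]mulr_natr natrM; lra.
  rewrite mulr_sumr -sumrB; apply: eq_bigr => m _.
  rewrite -normcM geo_telescope.
  have : normc (z ^+ m.+1) ^+ 2 = 1 by rewrite normc_exp z1 !expr1n.
  case: (z ^+ m.+1) => a b /=.
  rewrite !sqr_sqrtr ?addr_ge0 ?sqr_ge0 // oppr0 addr0 => ab1.
  by lra.
have ReB : complex.Re (z * geo (8 * N) z) <= 4 * N%:R.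
  apply: (le_trans (Re_le_normc _)); rewrite normcM z1 mul1r.
  have := normc_geo_telescope (8 * N) z1; rewrite -/w => gw.
  rewrite -(ler_pM2l w0); apply: (le_trans gw); nra.
have sw : 8 * N%:R <= w ^+ 2 * \sum_(m < 8 * N) normc (geo m.+1 z) ^+ 2.
  rewrite mulr_sumr; under eq_bigr do rewrite -exprMn.
  rewrite sumE; lra.
rewrite /majorant mulrA ler_pdivlMr ?exprn_gt0 //.
set S := \sum_(m < _) _ in sw *.
set g := normc (geo N z).
have : 0 <= N%:R * w ^+ 2 * (N%:R * g ^+ 2).
  by apply: mulr_ge0; apply: mulr_ge0; rewrite ?sqr_ge0 ?ler0n.
nra.
Qed.

(** The two bounds on [v], by height and by quadratic decay, are used on either side of
    [N |z-1| = 1/2]: [majorant_near] converts the first, [majorant_far] the second. *)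
Lemma le_majorant N z (v a b : R) : normc z = 1 -> (0 < N)%N ->
  0 <= a -> 0 <= b -> 0 <= v ->
  v <= a * N%:R -> v * (N%:R * normc (z - 1) ^+ 2) <= b ->
  v <= (4 * a + b) * majorant N z.
Proof.
move=> z1 N0 a0 b0 v0 va vb.
have := majorant_ge0 N z.
have Np : 0 < N%:R :> R by rewrite ltr0n.
have [near|far] := leP (N%:R * normc (z - 1)) 2^-1.
  have := majorant_near z1 N0 near; set M := majorant N z; nra.
have := majorant_far z1 N0 (ltW far).
set M := majorant N z; set q := N%:R * _ ^+ 2 in vb * => qM M0.
have q0 : 0 < q.
  have w0 : 0 < normc (z - 1) by nra.
  by rewrite mulr_gt0 // exprn_gt0.
have : v * q <= (b * M) * q by nra.
rewrite ler_pM2r // => ?; nra.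
Qed.

(** Transfers quadratic decay from one point to a neighbour at distance [d] of order [1/N]. In
    [w^2 <= 2 w'^2 + 2 d^2] the first term yields [2 b], and the second is paid for by the height
    bound: [2 a (N d)^2 <= 2 * 16^2 * a]. *)
Lemma sqr_shift (v w w' d N : R) (a b : R) : 0 <= v -> 0 < N -> 0 <= w -> 0 <= w' ->
  w <= w' + d -> 0 <= d -> N * d <= 16 ->
  v <= a * N -> v * (N * w' ^+ 2) <= b -> v * (N * w ^+ 2) <= 2 * b + 512 * a.
Proof.
move=> v0 N0 w0 w'0 ww' d0 Nd va vb.
have w2 : w ^+ 2 <= 2 * w' ^+ 2 + 2 * d ^+ 2.
  have : w ^+ 2 <= (w' + d) ^+ 2 by rewrite ler_pXn2r ?nnegrE ?addr_ge0.
  have := sqr_ge0 (w' - d); nra.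
have : v * (N * w ^+ 2) <= v * (N * (2 * w' ^+ 2 + 2 * d ^+ 2)).
  by rewrite ler_wpM2l // ler_wpM2l // ltW.
have : v * (N * d ^+ 2) <= 256 * a.
  have a0 : 0 <= a by nra.
  have : v * (N * d ^+ 2) <= a * N * (N * d ^+ 2).
    by apply: ler_wpM2r => //; apply: mulr_ge0; rewrite ?sqr_ge0 // ltW.
  have -> : a * N * (N * d ^+ 2) = a * (N * d) ^+ 2 by ring.
  have : (N * d) ^+ 2 <= 16 ^+ 2 by rewrite ler_pXn2r ?nnegrE // mulr_ge0 ?(ltW N0).
  nra.
nra.
Qed.

Lemma dirichlet_telescope n z : z != 0 ->
  (z - 1) * dirichlet n z = z ^+ n.+1 - z ^- n.
Proof.
move=> z0; rewrite /dirichlet mulrA geo_telescope mulrBl mul1r; congr (_ - _).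
have -> : (2 * n).+1 = (n.+1 + n)%N by rewrite mul2n -addnn addSn.
by rewrite exprD mulfK // expf_neq0.
Qed.

(* The Dirichlet kernel at [s] has the singular factor [(s - 1)^-1]; replacing
   it by [- cesaro_geo N z] at a neighbouring point [z] costs only an
   integrable error, while the oscillating numerator stays at [s]. *)
Lemma dirichlet_cesaro_le n N z s : N = (2 * n + 1)%N ->
  normc z = 1 -> normc s = 1 -> N%:R * normc (z - s) <= 16 ->
  normc (dirichlet n s + (s ^+ n.+1 - s ^- n) * cesaro_geo N z) <=
  304 * majorant N z.
Proof.
move=> NE z1 s1 zs.
have s0 : s != 0 by rewrite -normc_gt0 s1.
have N0 : (0 < N)%N by rewrite NE addn1.
have Np : 0 < N%:R :> R by rewrite ltr0n.
have NC0 : N%:R != 0 :> R[i] by rewrite pnatr_eq0 -lt0n.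
have normN : normc (N%:R : R[i]) = N%:R.
  by rewrite -[N%:R](rmorph_nat (real_complex R)) normc_real ger0_norm.
set num := s ^+ n.+1 - s ^- n; set D := dirichlet n s.
have num2 : normc num <= 2.
  apply: (le_trans (le_normcB _ _)).
  by rewrite normcV !normc_exp s1 !expr1n invr1.
have DN : normc D <= N%:R.
  rewrite normcM normcV normc_exp s1 expr1n invr1 mulr1 NE addn1.
  exact: normc_geo_le.
have QN : normc (cesaro_geo N z) <= N%:R.
  rewrite normcM normcV normN ler_pdivrMl //.
  apply: (le_trans (normc_sum _ _ _)).
  rewrite mulr_natr -[X in _ *+ X]card_ord -sumr_const; apply: ler_sum => m _.
  by apply: (le_trans (normc_geo_le _ z1)); rewrite ler_nat.
have eN : normc (D + num * cesaro_geo N z) <= 3 * N%:R.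
  apply: (le_trans (le_normcD _ _)); rewrite normcM.
  have := normc_ge0 num; have := normc_ge0 (cesaro_geo N z); nra.
(* Multiplying by [z - 1] removes the singularity: [(z-1) D] is [num] plus the displacement term
   [D (z-s)], while the Cesaro term contributes [- num] plus a remainder with the factor [1/N], so
   [num] cancels. *)
have eE : (z - 1) * (D + num * cesaro_geo N z) =
    num * (N%:R^-1 * (z * geo N z)) + D * (z - s).
  rewrite mulrDr [X in _ + X]mulrCA cesaro_geo_telescope //.
  have : (s - 1) * D = num by exact: dirichlet_telescope.
  by move=> <-; ring.
set e := D + _ in eN eE *.
have ew : normc (z - 1) * normc e <=
    2 * (N%:R^-1 * normc (geo N z)) + normc D * normc (z - s).
  rewrite -normcM eE; apply: (le_trans (le_normcD _ _)).
  rewrite !normcM normcV normN z1 mul1r lerD2r ler_wpM2r //.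
  by rewrite mulr_ge0 ?normc_ge0 // invr_ge0 ltW.
have gw := normc_geo_telescope N z1.
have Ds : normc (s - 1) * normc D <= 2.
  by rewrite -normcM dirichlet_telescope.
have ws : normc (z - 1) <= normc (s - 1) + normc (z - s).
  by have := le_normcD (s - 1) (z - s); rewrite addrC subrKA.
(* 3 comes from the height bound [3N]. The decay bound is [292 = 2 * 2 + 16 * 18], where 18 bounds
   [|D| |z-1|] as [|D| |s-1| + |D| |z-s| <= 2 + 16]. *)
rewrite (_ : 304 = 4 * 3 + 292); last by ring.
apply: (le_majorant z1 N0 (ler0n _ _) (ler0n _ _) (normc_ge0 _) eN).
move: (normc_ge0 e) (normc_ge0 (z - 1)) (normc_ge0 D) (normc_ge0 (z - s)).
move: gw Ds ws ew zs DN.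
set w := normc (z - 1); set ne := normc e; set g := normc (geo N z).
set d := normc (z - s); set nD := normc D; set u := normc (s - 1).
move=> gw Du wu ew Nd DN e0 w0 D0 d0.
have Dw : nD * w <= 18.
  have : nD * w <= nD * (u + d) by rewrite ler_wpM2l.
  have : nD * d <= N%:R * d by rewrite ler_wpM2r.
  nra.
have -> : ne * (N%:R * w ^+ 2) = N%:R * w * (w * ne) by ring.
have : N%:R * w * (w * ne) <= N%:R * w * (2 * (N%:R^-1 * g) + nD * d).
  by rewrite ler_wpM2l // mulr_ge0 // ltW.
have -> : N%:R * w * (2 * (N%:R^-1 * g) + nD * d) =
    2 * (w * g) + (N%:R * d) * (nD * w).
  by field; rewrite gt_eqF.
have Nd0 : 0 <= N%:R * d by rewrite mulr_ge0 // ltW.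
have Dw0 : 0 <= nD * w by rewrite mulr_ge0.
nra.
Qed.

(** The difference of squares has height at most [4 N^2] and satisfies [|v| |s-1|^2 <= 4]. After
    division by [N], [sqr_shift] moves the decay from [s] to [z] and [le_majorant] concludes, with
    constant [4 * 4 + (2 * 4 + 512 * 4) = 2072], rounded up to 3000. *)
Lemma vallee_poussin_le N z s : (0 < N)%N -> normc z = 1 -> normc s = 1 ->
  N%:R * normc (z - s) <= 16 ->
  `|normc (geo (2 * N) s) ^+ 2 - normc (geo N s) ^+ 2| <=
  N%:R * (3000 * majorant N z).
Proof.
move=> N0 z1 s1 zs.
have Np : 0 < N%:R :> R by rewrite ltr0n.
set v := _ - _.
have v4 : `|v| <= 4 * N%:R * N%:R.
  have g2 : normc (geo (2 * N) s) <= 2 * N%:R.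
    by rewrite -natrM; exact: normc_geo_le.
  have g1 := normc_geo_le N s1.
  have {}g2 : normc (geo (2 * N) s) ^+ 2 <= (2 * N%:R) ^+ 2.
    by rewrite ler_pXn2r ?nnegrE ?normc_ge0 ?mulr_ge0.
  have {}g1 : normc (geo N s) ^+ 2 <= N%:R ^+ 2.
    by rewrite ler_pXn2r ?nnegrE ?normc_ge0.
  move: (sqr_ge0 (normc (geo (2 * N) s))) (sqr_ge0 (normc (geo N s))) => ? ?.
  by rewrite ler_norml; apply/andP; split; rewrite /v; lra.
have vw : `|v| * normc (s - 1) ^+ 2 <= 4.
  have := normc_geo_telescope (2 * N) s1; have := normc_geo_telescope N s1.
  set p := normc (s - 1).
  have -> : `|v| * p ^+ 2 = `|v * p ^+ 2| by rewrite normrM (ger0_norm (sqr_ge0 p)).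
  rewrite /v mulrBl -!exprMn.
  have p0 : 0 <= p := normc_ge0 _.
  move: (normc_ge0 (geo (2 * N) s)) (normc_ge0 (geo N s)) => g0 h0.
  rewrite ![p * _]mulrC; move: (mulr_ge0 g0 p0) (mulr_ge0 h0 p0).
  move: (_ * p) (_ * p) => x y x0 y0 x2 y2.
  have sq (t : R) : 0 <= t -> t <= 2 -> 0 <= t ^+ 2 <= 4.
    by move=> ? ?; rewrite sqr_ge0 /=; nra.
  have /andP[? ?] := sq _ x0 y2; have /andP[? ?] := sq _ y0 x2.
  by rewrite ler_norml; apply/andP; split; lra.
have {}v4 : `|v| / N%:R <= 4 * N%:R by rewrite ler_pdivrMr.
have {}vw : `|v| / N%:R * (N%:R * normc (s - 1) ^+ 2) <= 4.
  by rewrite mulrA divfK // gt_eqF.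
have v0 : 0 <= `|v| / N%:R by rewrite divr_ge0.
have ws : normc (z - 1) <= normc (s - 1) + normc (z - s).
  by have := le_normcD (s - 1) (z - s); rewrite addrC subrKA.
have sh := sqr_shift v0 Np (normc_ge0 _) (normc_ge0 _) ws (normc_ge0 _) zs v4 vw.
rewrite -ler_pdivrMl // mulrC.
have b0 : 0 <= 2 * 4 + 512 * 4 :> R by lra.
apply: (le_trans (le_majorant z1 N0 (ler0n _ 4) b0 v0 v4 sh)).
by apply: ler_wpM2r; [exact: majorant_ge0|lra].
Qed.

End KernelEstimates.

(** * Bounded measurable functions on the torus *)

Section BoundedMeasurable.
Variable R : realType.
Notation mu := (@lebesgue_measure R).
Implicit Types (f g : R -> R[i]).

(** The working class of the proof: it is closed under sums, products and moduli, and by [bmeas_mem]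
    it lies in every [X]. This settles membership where domination by an element of [X] would
    not. *)
Definition bmeas f : Prop :=
  cmeasurable f /\ exists M : R, forall x, normc (f x) <= M.

Lemma measurable_torus : measurable (torus R).
Proof. exact: measurable_itv. Qed.

Lemma torus_ltey : (mu (torus R) < +oo)%E.
Proof. by rewrite /torus lebesgue_measure_itv /=; case: ifP => _; rewrite ltry. Qed.

Lemma bmeas_add f g : bmeas f -> bmeas g -> bmeas (fun x => f x + g x).
Proof.
move=> [[fr fi] [M fM]] [[gr gi] [M' gM]]; split.
  split.
    rewrite (_ : (fun _ => _) = (fun x => complex.Re (f x)) \+ (fun x => complex.Re (g x))).
      exact: measurable_funD.
    by apply/funext => x /=; case: (f x) (g x) => ? ? [? ?].
  rewrite (_ : (fun _ => _) = (fun x => complex.Im (f x)) \+ (fun x => complex.Im (g x))).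
    exact: measurable_funD.
  by apply/funext => x /=; case: (f x) (g x) => ? ? [? ?].
by exists (M + M') => x; apply: (le_trans (le_normcD _ _)); rewrite lerD.
Qed.

Lemma bmeas_mul f g : bmeas f -> bmeas g -> bmeas (fun x => f x * g x).
Proof.
move=> [[fr fi] [M fM]] [[gr gi] [M' gM]]; split.
  split.
    rewrite (_ : (fun _ => _) =
        ((fun x => complex.Re (f x)) \* (fun x => complex.Re (g x))) \-
        ((fun x => complex.Im (f x)) \* (fun x => complex.Im (g x)))).
      by apply: measurable_funB; apply: measurable_funM.
    by apply/funext => x /=; case: (f x) (g x) => ? ? [? ?].
  rewrite (_ : (fun _ => _) =
      ((fun x => complex.Re (f x)) \* (fun x => complex.Im (g x))) \+
      ((fun x => complex.Im (f x)) \* (fun x => complex.Re (g x)))).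
    by apply: measurable_funD; apply: measurable_funM.
  by apply/funext => x /=; case: (f x) (g x) => ? ? [? ?].
by exists (M * M') => x; rewrite normcM ler_pM ?normc_ge0.
Qed.

Lemma bmeas_cst (c : R[i]) : bmeas (fun=> c).
Proof.
by split; [split; exact: measurable_cst|exists (normc c)].
Qed.

Lemma bmeas_opp f : bmeas f -> bmeas (fun x => - f x).
Proof.
move=> /(bmeas_mul (bmeas_cst (-1))); congr bmeas.
by apply/funext => x; rewrite mulN1r.
Qed.

Lemma bmeas_sum (I : Type) (r : seq I) (F : I -> R -> R[i]) :
  (forall i, bmeas (F i)) -> bmeas (fun x => \sum_(i <- r) F i x).
Proof.
move=> FP; elim: r => [|i r IH].
  by under eq_fun do rewrite big_nil; exact: bmeas_cst.
by under eq_fun do rewrite big_cons; exact: bmeas_add.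
Qed.

Lemma bmeas_real (h : R -> R) (M : R) : measurable_fun (torus R) h ->
  (forall x, `|h x| <= M) -> bmeas (fun x => (h x)%:C).
Proof.
move=> mh hM; split; first by split=> //; exact: measurable_cst.
by exists M => x; rewrite normc_real.
Qed.

Lemma measurable_normc f : cmeasurable f ->
  measurable_fun (torus R) (fun x => normc (f x)).
Proof.
move=> [fr fi].
rewrite (_ : (fun _ => _) = Num.sqrt \o ((fun x => complex.Re (f x) ^+ 2) \+
    (fun x => complex.Im (f x) ^+ 2))).
  apply: measurableT_comp; last by apply: measurable_funD; exact: measurable_funX.
  by apply: continuous_measurable_fun; exact: sqrt_continuous.
by apply/funext => x /=; case: (f x).
Qed.

Lemma bmeas_normc f : bmeas f -> bmeas (fun x => (normc (f x))%:C).
Proof.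
move=> [/measurable_normc mf [M fM]]; apply: (@bmeas_real _ M) => // x.
by rewrite ger0_norm ?normc_ge0 ?fM.
Qed.

Lemma bmeas_indic (B : set R) : measurable B -> bmeas (cindic B).
Proof.
move=> mB; apply: (@bmeas_real _ 1); first exact: measurable_indic.
by move=> x; rewrite indicE ger0_norm ?ler0n // lern1 leq_b1.
Qed.

Lemma bmeas_expi (h : R -> R) : measurable_fun setT h ->
  bmeas (fun x => expi (h x)).
Proof.
move=> /(measurable_funTS (D := torus R)) mh; split; last by exists 1 => x; rewrite normc_expi.
split.
  apply: (measurableT_comp (f := @cos R) _ mh).
  exact: continuous_measurable_fun (@continuous_cos R).
apply: (measurableT_comp (f := @sin R) _ mh).
exact: continuous_measurable_fun (@continuous_sin R).
Qed.

Lemma bmeas_integrable f : bmeas f -> cintegrable f.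
Proof.
have int (h : R -> R) M : measurable_fun (torus R) h ->
    (forall x, `|h x| <= M) -> mu.-integrable (torus R) (EFin \o h).
  move=> mh hM; apply: measurable_bounded_integrable => //.
  - exact: measurable_torus.
  - exact: torus_ltey.
  - by exists M; split; [exact: num_real|move=> N MN x _; exact: le_trans (hM x) (ltW MN)].
move=> [[fr fi] [M fM]]; split; apply: (int _ M) => // x.
  apply: le_trans (fM x); case: (f x) => a b /=.
  by rewrite -sqrtr_sqr ler_wsqrtr // lerDl sqr_ge0.
apply: le_trans (fM x); case: (f x) => a b /=.
by rewrite -sqrtr_sqr ler_wsqrtr // lerDr sqr_ge0.
Qed.

End BoundedMeasurable.

(** * The complex integral over one period *)

Section ComplexIntegral.
Variable R : realType.
Notation mu := (@lebesgue_measure R).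
Implicit Types (f g : R -> R[i]).

Lemma cintegral_add f g : cintegrable f -> cintegrable g ->
  cintegral (fun x => f x + g x) = cintegral f + cintegral g.
Proof.
move=> [fr fi] [gr gi]; rewrite /cintegral; simpc; congr (_ +i* _).
  rewrite -RintegralD //; last exact: measurable_torus.
  by congr Rintegral; apply/funext => x; case: (f x) (g x) => ? ? [? ?].
rewrite -RintegralD //; last exact: measurable_torus.
by congr Rintegral; apply/funext => x; case: (f x) (g x) => ? ? [? ?].
Qed.

Lemma integrable_EFinZ (a : R) (h : R -> R) :
  mu.-integrable (torus R) (EFin \o h) ->
  mu.-integrable (torus R) (EFin \o (fun x => a * h x)).
Proof.
move=> hi; rewrite (_ : EFin \o _ = (fun x => a%:E * (EFin \o h) x)%E).
  by apply: integrableZl => //; exact: measurable_torus.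
by apply/funext => x /=; rewrite EFinM.
Qed.

Lemma cintegrableZ (c : R[i]) f : cintegrable f -> cintegrable (fun x => c * f x).
Proof.
have mT := @measurable_torus R.
move=> [fr fi]; case: c => a b; split.
  rewrite (_ : (fun _ => _) = ((EFin \o (fun x => a * complex.Re (f x))%R) \-
     (EFin \o (fun x => b * complex.Im (f x))%R))%E).
    by apply: integrableB => //; exact: integrable_EFinZ.
  by apply/funext => x /=; case: (f x).
rewrite (_ : (fun _ => _) = ((EFin \o (fun x => a * complex.Im (f x))%R) \+
   (EFin \o (fun x => b * complex.Re (f x))%R))%E).
  by apply: integrableD => //; exact: integrable_EFinZ.
by apply/funext => x /=; case: (f x).
Qed.

Lemma cintegralZ (c : R[i]) f : cintegrable f ->
  cintegral (fun x => c * f x) = c * cintegral f.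
Proof.
move=> [fr fi]; case: c => a b; rewrite /cintegral; simpc.
have mT := @measurable_torus R.
congr (_ +i* _).
  rewrite -!RintegralZl // -RintegralB //; try exact: integrable_EFinZ.
  by congr Rintegral; apply/funext => x; case: (f x).
rewrite -!RintegralZl // -RintegralD //; try exact: integrable_EFinZ.
by congr Rintegral; apply/funext => x; case: (f x) => ? ? /=.
Qed.

Lemma eq_cintegral f g : {in torus R, f =1 g} -> cintegral f = cintegral g.
Proof.
by move=> fg; rewrite /cintegral; congr (_ +i* _); apply: eq_Rintegral => x /fg ->.
Qed.

Lemma cintegral0 : cintegral (fun=> 0) = 0 :> R[i].
Proof.
rewrite -[LHS](_ : cintegral (fun=> 0 * 0) = _).
  by rewrite cintegralZ ?mul0r //; exact/bmeas_integrable/bmeas_cst.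
by congr cintegral; apply/funext => x; rewrite mul0r.
Qed.

Lemma cintegral_sum (I : Type) (r : seq I) (F : I -> R -> R[i]) :
  (forall i, bmeas (F i)) ->
  cintegral (fun x => \sum_(i <- r) F i x) = \sum_(i <- r) cintegral (F i).
Proof.
move=> FP; elim: r => [|i r IH].
  by under eq_fun do rewrite big_nil; rewrite big_nil cintegral0.
under eq_fun do rewrite big_cons.
rewrite cintegral_add ?IH ?big_cons //; first exact: bmeas_integrable.
exact/bmeas_integrable/bmeas_sum.
Qed.

(* Rotating the integral onto the positive real axis reduces the bound to the
   real part. *)
Lemma normc_cintegral_le f g : cintegrable f -> cintegrable g ->
  (forall x, torus R x -> normc (f x) <= complex.Re (g x)) ->
  normc (cintegral f) <= complex.Re (cintegral g).
Proof.
move=> fi gi fg; set I := cintegral f.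
have Re_le h : cintegrable h -> (forall x, torus R x -> normc (h x) <= complex.Re (g x)) ->
    complex.Re (cintegral h) <= complex.Re (cintegral g).
  move=> [hr _] hg; apply: le_Rintegral => //.
  - exact: measurable_torus.
  - by case: gi.
  - by move=> x /hg; apply: le_trans; exact: Re_le_normc.
have [->|I0] := eqVneq I 0.
  rewrite normc0 -[0](_ : complex.Re (cintegral (fun=> 0)) = _); last first.
    by rewrite cintegral0.
  apply: Re_le => [|x /fg]; first exact/bmeas_integrable/bmeas_cst.
  by apply: le_trans; rewrite normc0 normc_ge0.
have nI : 0 < normc I by rewrite normc_gt0.
pose u := ((normc I)^-1)%:C * I^*.
have u1 : normc u = 1.
  rewrite normcM normc_conj normc_real ger0_norm ?invr_ge0 ?normc_ge0 //.
  by rewrite mulVf // gt_eqF.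
have -> : normc I = complex.Re (cintegral (fun x => u * f x)).
  rewrite cintegralZ // -/I /u -mulrA [_^* * _]mulrC mulr_conj_normc -rmorphM /=.
  by rewrite expr2 mulrA mulVf ?mul1r // gt_eqF.
apply: Re_le => [|x /fg]; last by rewrite normcM u1 mul1r.
exact: cintegrableZ.
Qed.

Lemma cintegral_indic (a b : R) : 0 <= a -> a <= b -> b <= 2 * pi ->
  cintegral (cindic `[a, b[%classic) = (b - a)%:C.
Proof.
move=> a0 ab b2; rewrite /cintegral.
have mT := @measurable_torus R.
rewrite /= Rintegral_cst // mul0r; congr (_ +i* _).
rewrite /Rintegral integral_indic //.
rewrite setIidl.
  transitivity (fine (b - a)%:E) => //; congr fine; transitivity (mu `[a, b[%classic) => //.
  rewrite lebesgue_measure_itv /= lte_fin; case: ltP => //= ba.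
  by congr EFin; lra.
by move=> x /=; rewrite /torus /= !in_itv /= => /andP[? ?]; apply/andP; split; lra.
Qed.

Lemma Rintegral_FTC (F f : R -> R) (a b : R) : a < b -> continuous f ->
  (forall t : R, is_derive t 1 F (f t)) ->
  \int[mu]_(x in `[a, b]) f x = F b - F a.
Proof.
move=> ab cf dF; rewrite /Rintegral (@continuous_FTC2 _ f F) //.
- exact: continuous_subspaceT.
- have cF : continuous F by move=> t; apply/differentiable_continuous/derivable1_diffP; exact: ex_derive.
  split; [by move=> t _; exact: ex_derive|apply: cvg_at_right_filter; exact: cF
    |apply: cvg_at_left_filter; exact: cF].
- by move=> t _; rewrite derive1E derive_val.
Qed.

(** The antiderivatives [sin (k y) / k] and [- cos (k y) / k] take the same value at 0 and at
    [2 pi]. *)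
Lemma cintegral_expi (k : R) : k != 0 -> expi (k * (2 * pi)) = 1 ->
  cintegral (fun y => expi (k * y)) = 0.
Proof.
move=> k0 [cos2k sin2k].
have pi2 : 0 < 2 * pi :> R by rewrite mulr_gt0 ?pi_gt0.
have [ir ii] : cintegrable (fun y => expi (k * y) : R[i]).
  by apply/bmeas_integrable/bmeas_expi/measurable_funM; [exact: measurable_cst|].
have dk (t : R) : is_derive t 1 (fun y => k * y) k.
  by apply: is_derive_eq; rewrite /GRing.scale /=; ring.
have dS (t : R) : is_derive t 1 (fun y => k^-1 * sin (k * y)) (cos (k * t)).
  have ? := is_derive1_comp (is_derive_sin (k * t)) (dk t).
  by apply: is_derive_eq; rewrite /GRing.scale /=; field.
have dC (t : R) : is_derive t 1 (fun y => - k^-1 * cos (k * y)) (sin (k * t)).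
  have ? := is_derive1_comp (is_derive_cos (k * t)) (dk t).
  by apply: is_derive_eq; rewrite /GRing.scale /=; field.
rewrite /cintegral /torus; congr (_ +i* _).
  rewrite Rintegral_itv_bndo_bndc //.
  apply: (etrans (Rintegral_FTC pi2 _ dS)).
    by move=> t; apply: continuous_comp; [exact: mulrl_continuous|exact: continuous_cos].
  by rewrite sin2k !mulr0 sin0 mulr0 subrr.
rewrite Rintegral_itv_bndo_bndc //.
apply: (etrans (Rintegral_FTC pi2 _ dC)).
  by move=> t; apply: continuous_comp; [exact: mulrl_continuous|exact: continuous_sin].
by rewrite cos2k mulr0 cos0 subrr.
Qed.

End ComplexIntegral.

(** * The lattice norm, and membership of bounded measurable functions *)

Section Lattice.
Variables (R : realType) (X : banach_lattice R).
Notation mu := (@lebesgue_measure R).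
Implicit Types (f g u v : R -> R[i]).

Lemma ae_torusW (P : R -> Prop) : (forall x, torus R x -> P x) -> ae_torus P.
Proof. by move=> H; apply: aeW => x; exact: H. Qed.

Lemma ae_torusS (P Q : R -> Prop) : (forall x, torus R x -> P x -> Q x) ->
  ae_torus P -> ae_torus Q.
Proof.
move=> PQ; apply: (@filterS _ _ (ae_filter_ringOfSetsType mu)) => x Px Tx.
by apply: PQ => //; exact: Px.
Qed.

Lemma bl_norm_le_normc f g : bl_mem X f -> bl_mem X g ->
  ae_torus (fun x => normc (f x) <= normc (g x)) -> bl_norm X f <= bl_norm X g.
Proof.
move=> fX gX; move/ae_torusS=> fg; apply: bl_norm_le => //; apply: fg => x _.
by rewrite !normr_normc lecR.
Qed.

Lemma bl_norm_eq_normc f g : bl_mem X f -> bl_mem X g ->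
  ae_torus (fun x => normc (f x) = normc (g x)) -> bl_norm X f = bl_norm X g.
Proof.
move=> fX gX fg; apply/eqP; rewrite eq_le.
by rewrite !bl_norm_le_normc //; apply: ae_torusS fg => x _ ->.
Qed.

Lemma bl_mem0 : bl_mem X (fun=> 0).
Proof.
have := bl_scale 0 (bl_indic X measurable0 (@sub0set _ _)); congr (bl_mem X).
by apply/funext => x; rewrite mul0r.
Qed.

Lemma bl_norm0 : bl_norm X (fun=> 0) = 0.
Proof. by apply/(bl_norm_eq0 bl_mem0); exact: ae_torusW. Qed.

Lemma bl_norm_ge0 f : bl_mem X f -> 0 <= bl_norm X f.
Proof.
move=> fX; rewrite -bl_norm0; apply: bl_norm_le_normc => //; first exact: bl_mem0.
by apply: ae_torusW => x _; rewrite normc0 normc_ge0.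
Qed.

Lemma bl_mem_sum (I : Type) (r : seq I) (F : I -> R -> R[i]) :
  (forall i, bl_mem X (F i)) -> bl_mem X (fun x => \sum_(i <- r) F i x).
Proof.
move=> FX; elim: r => [|i r IH].
  by under eq_fun do rewrite big_nil; exact: bl_mem0.
by under eq_fun do rewrite big_cons; exact: bl_add.
Qed.

Lemma bl_norm_sum (I : Type) (r : seq I) (F : I -> R -> R[i]) :
  (forall i, bl_mem X (F i)) ->
  bl_norm X (fun x => \sum_(i <- r) F i x) <= \sum_(i <- r) bl_norm X (F i).
Proof.
move=> FX; elim: r => [|i r IH].
  by under eq_fun do rewrite big_nil; rewrite big_nil bl_norm0.
under eq_fun do rewrite big_cons; rewrite big_cons.
by apply: (le_trans (bl_normD (FX i) (bl_mem_sum r FX))); rewrite lerD2l.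
Qed.

Lemma bl_sub f g : bl_mem X f -> bl_mem X g -> bl_mem X (fun x => f x - g x).
Proof.
move=> fX gX; have := bl_add fX (bl_scale (-1) gX); congr (bl_mem X).
by apply/funext => x; rewrite mulN1r.
Qed.

Let one := cindic (torus R).

Lemma bl_mem_torus : bl_mem X one.
Proof. by apply: bl_indic => //; exact: measurable_torus. Qed.

Lemma bl_norm_unif u v (e : R) : bl_mem X u -> bl_mem X v ->
  (forall x, torus R x -> normc (u x - v x) <= e) ->
  bl_norm X (fun x => u x - v x) <= `|e| * bl_norm X one.
Proof.
move=> uX vX uve; rewrite -(normc_real e) -bl_normZ; last exact: bl_mem_torus.
apply: bl_norm_le_normc; [exact: bl_sub|exact/bl_scale/bl_mem_torus|].
apply: ae_torusW => x Tx; apply: (le_trans (uve x Tx)).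
by rewrite /one /cindic indicE mem_set // mulr1 normc_real ler_norm.
Qed.

(* If [f] and [g] differed on a set of positive measure, then [u m - g] would
   stay above a fixed multiple of an indicator function. *)
Lemma unif_limit_ae f g (u : nat -> R -> R[i]) : cmeasurable f -> bl_mem X g ->
  (forall m, bl_mem X (u m)) ->
  (forall m x, torus R x -> normc (f x - u m x) <= m.+1%:R^-1) ->
  (fun m => bl_norm X (fun x => u m x - g x)) @ \oo --> (0 : R) ->
  ae_torus (fun x => f x = g x).
Proof.
move=> mf gX uX fu ug.
have mg : cmeasurable g.
  have [gr gi] := bl_L1 gX.
  by split; apply/measurable_EFinP; [case/integrableP : gr|case/integrableP : gi].
have md : measurable_fun (torus R) (fun x => normc (f x - g x)).
  apply: measurable_normc; case: mf mg => [fr fi] [gr gi]; split.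
    rewrite (_ : (fun _ => _) = (fun x => complex.Re (f x)) \- (fun x => complex.Re (g x))).
      exact: measurable_funB.
    by apply/funext => x /=; case: (f x) (g x) => ? ? [? ?].
  rewrite (_ : (fun _ => _) = (fun x => complex.Im (f x)) \- (fun x => complex.Im (g x))).
    exact: measurable_funB.
  by apply/funext => x /=; case: (f x) (g x) => ? ? [? ?].
pose B (j : nat) := torus R `&` (fun x => normc (f x - g x)) @^-1` `[j.+1%:R^-1, +oo[.
have BX j : bl_mem X (cindic (B j)).
  apply: bl_indic; last exact: subIsetl.
  by apply: md; [exact: measurable_torus|exact: measurable_itv].
have B0 j : bl_norm X (cindic (B j)) = 0.
  apply/eqP; rewrite eq_le bl_norm_ge0 // andbT leNgt; apply/negP => Bpos.
  (* On [B j] the distance of [f] and [g] is at least [2 / c]. Once [m + 1 >= c], [u m] is within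
     [1 / c] of [f], so [|u m - g| >= 1 / c] there, and [c |u m - g|] dominates the indicator of
     [B j]. *)
  pose c : R := 2 * j.+1%:R.
  have c0 : 0 < c by rewrite mulr_gt0 ?ltr0n.
  have /cvgrPdist_lt /(_ (bl_norm X (cindic (B j)) / c) (divr_gt0 Bpos c0)) := ug.
  move=> [N _ uN]; pose m := maxn N (2 * j.+1).
  have := uN m (leq_maxl _ _).
  rewrite /= sub0r normrN ger0_norm; last exact/bl_norm_ge0/bl_sub.
  apply/negP; rewrite -leNgt ler_pdivrMr //.
  rewrite mulrC -(ger0_norm (ltW c0)) -normc_real -bl_normZ; last exact: bl_sub.
  apply: bl_norm_le_normc => //; first exact/bl_scale/bl_sub.
  apply: ae_torusW => x Tx; rewrite /cindic indicE.
  have [/set_mem[_ jx]|_] := boolP (x \in B j); last by rewrite normc0 normc_ge0.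
  have {}jx : j.+1%:R^-1 <= normc (f x - g x).
    by move: jx; rewrite /= in_itv /= andbT.
  rewrite normc_real normr1 normcM normc_real (ger0_norm (ltW c0)).
  have m1 : m.+1%:R^-1 <= (c^-1 : R).
    rewrite lef_pV2 ?posrE ?ltr0n // /c -natrM ler_nat.
    by rewrite ltnW // ltnS leq_maxr.
  have := le_normcD (f x - u m x) (u m x - g x); rewrite subrKA => tri.
  have := fu m x Tx; move: m1 jx tri.
  have -> : (j.+1%:R^-1 : R) = 2 * c^-1 by rewrite /c invfM mulVKf ?pnatr_eq0.
  move=> h1 h2 h3 /le_trans /(_ h1) h4; have : c^-1 <= normc (u m x - g x) by lra.
  by rewrite -ler_pdivrMl // mulr1.
have Bae j : ae_torus (fun x => cindic (B j) x = 0) by apply/(bl_norm_eq0 (BX j)).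
have := @ae_foralln _ _ _ mu _ Bae.
apply: filterS => x Hx Tx; apply/eqP; rewrite -subr_eq0; apply/negPn/negP.
rewrite -normc_gt0 => d0; set d := normc _ in d0.
(* A point where [f] and [g] differ by [d > 0] belongs to [B j] for [j] the integer part of [1/d],
   since [j + 1 > 1/d]. *)
have := Hx (Num.truncn d^-1) Tx; rewrite /cindic indicE mem_set /=.
  by move=> [] /eqP; rewrite oner_eq0.
split=> //=; rewrite in_itv /= andbT -/d.
rewrite -[leRHS]invrK lef_pV2 ?posrE ?invr_gt0 ?ltr0n //.
exact/ltW/truncnS_gt.
Qed.

(** The sum counts the integers from 1 to [L] not exceeding [y], that is, the integer part of [y]
    capped at [L]. It evaluates the layered approximations in [bl_mem_real]. *)
Lemma count_le (y : R) (L : nat) : 0 <= y ->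
  let c : R := \sum_(k < L) (k.+1%:R <= y)%R%:R in
  c <= y /\ (y < c + 1 \/ c = L%:R).
Proof.
move=> y0 c; suff : [/\ c <= y, c <= L%:R & (y < c + 1 \/ c = L%:R)] by case.
rewrite {}/c; elim: L => [|L [cy cL H]]; first by rewrite big_ord0; split=> //; right.
rewrite big_ord_recr /=; move: (\sum_(k < L) _) cy cL H => c cy cL H.
have LS : L.+1%:R = L%:R + 1 :> R by rewrite -natr1.
case: (leP L.+1%:R y) => /= Ly; rewrite ?addr0.
  by case: H => [|->]; rewrite LS in Ly *; [lra|split; [lra|lra|right]].
by split; [lra|lra|left; case: H => [|->]; lra].
Qed.

(** Finite combinations of indicators of superlevel sets approximate [h] uniformly. As constants lie
    in [X], uniform convergence makes them Cauchy in norm; completeness gives a limit in [X],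
    [unif_limit_ae] identifies it with [h] almost everywhere, and saturation under such equality
    puts [h] in [X]. *)
Lemma bl_mem_real (h : R -> R) (M : nat) : measurable_fun (torus R) h ->
  (forall x, 0 <= h x <= M%:R) -> bl_mem X (fun x => (h x)%:C).
Proof.
move=> mh hM.
pose A (m k : nat) := torus R `&` h @^-1` `[k.+1%:R / m.+1%:R, +oo[.
pose s (m : nat) (x : R) : R[i] :=
  \sum_(k < M * m.+1) (m.+1%:R^-1 : R)%:C * cindic (A m k) x.
have sX m : bl_mem X (s m).
  apply: bl_mem_sum => k; apply: bl_scale; apply: bl_indic; last exact: subIsetl.
  by apply: mh; [exact: measurable_torus|exact: measurable_itv].
have hs m x : torus R x -> normc ((h x)%:C - s m x) <= m.+1%:R^-1.
  move=> Tx; have m0 : 0 < m.+1%:R :> R by rewrite ltr0n.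
  have /andP[h0 hM'] := hM x.
  pose c : R := \sum_(k < M * m.+1) (k.+1%:R <= h x * m.+1%:R)%R%:R.
  have -> : s m x = (c / m.+1%:R)%:C.
    rewrite /c mulr_suml rmorph_sum; apply: eq_bigr => k _.
    rewrite mulrC /cindic -rmorphM indicE; congr (_ * _)%:C.
    rewrite -ler_pdivrMr //; congr (nat_of_bool _)%:R.
    apply/idP/idP => [/set_mem[_]|H]; first by rewrite /= in_itv /= andbT.
    by apply/mem_set; split=> //=; rewrite in_itv /= andbT.
  rewrite -rmorphB normc_real.
  have [|cy] := @count_le (h x * m.+1%:R) (M * m.+1); first by rewrite mulr_ge0.
  rewrite -/c => cE.
  have cy1 : h x * m.+1%:R <= c + 1.
    case: cE => [/ltW //|->].
    rewrite natrM; apply: le_trans (_ : M%:R * m.+1%:R <= _); last by rewrite lerDl.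
    by rewrite ler_wpM2r // ltW.
  rewrite ger0_norm; last by rewrite subr_ge0 ler_pdivrMr.
  by rewrite lerBlDl -[X in _ + X]div1r -mulrDl ler_pdivlMr.
have [g gX sg] : exists2 g, bl_mem X g &
    (fun m => bl_norm X (fun x => s m x - g x)) @ \oo --> (0 : R).
  apply: bl_complete => // e e0; set K := bl_norm X one.
  have K0 : 0 <= K by exact/bl_norm_ge0/bl_mem_torus.
  (* Beyond this index [2 K / (r + 1) < e], so the errors at [p] and at [q] contribute less than
     [e / 2] each. *)
  exists (Num.truncn (2 * K / e)) => p q Np Nq.
  have inv_le r : (Num.truncn (2 * K / e) <= r)%N -> r.+1%:R^-1 * (2 * K) < e.
    move=> Nr; rewrite mulrC ltr_pdivrMr ?ltr0n // -ltr_pdivrMl // mulrC.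
    by apply: (lt_le_trans (truncnS_gt _)); rewrite ler_nat.
  apply: (@le_lt_trans _ _ (`|p.+1%:R^-1 + q.+1%:R^-1| * K)).
    apply: bl_norm_unif => // x Tx.
    have -> : s p x - s q x = ((h x)%:C - s q x) - ((h x)%:C - s p x).
      by rewrite opprB [RHS]addrC subrKA.
    by apply: (le_trans (le_normcB _ _)); rewrite addrC lerD ?hs.
  rewrite ger0_norm ?addr_ge0 ?invr_ge0 ?ler0n //.
  move: (inv_le p Np) (inv_le q Nq).
  by move: (p.+1%:R^-1) (q.+1%:R^-1) => a b; lra.
have hc : cmeasurable (fun x => (h x)%:C) by split=> //; exact: measurable_cst.
apply: (bl_ae gX hc); apply: ae_torusS (unif_limit_ae hc gX sX hs sg) => x _ ->.
by [].
Qed.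

(** Real and imaginary parts are treated separately: adding the constant [N] makes each nonnegative,
    so that [bl_mem_real] applies, and the constant is then subtracted inside [X]. *)
Lemma bmeas_mem f : bmeas f -> bl_mem X f.
Proof.
move=> [[fr fi] [M fM]]; pose N := (Num.truncn M).+1.
have fN x : normc (f x) <= N%:R.
  exact: le_trans (fM x) (ltW (truncnS_gt _)).
have mem_part (h : R -> R) : measurable_fun (torus R) h ->
    (forall x, `|h x| <= N%:R) -> bl_mem X (fun x => (h x)%:C).
  move=> mh hN.
  have cX : bl_mem X (fun=> (N%:R : R)%:C).
    by apply: (@bl_mem_real _ N); [exact: measurable_cst|move=> x; rewrite ler0n lexx].
  have := @bl_mem_real (h \+ cst N%:R) (N + N) (measurable_funD mh (measurable_cst _)).
  have hb x : 0 <= (h \+ cst N%:R) x <= (N + N)%:R.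
    by have := hN x; rewrite ler_norml natrD /= => /andP[? ?]; apply/andP; split; lra.
  move=> /(_ hb) /bl_sub /(_ cX); congr (bl_mem X).
  by apply/funext => x; rewrite /= -rmorphB addrK.
have := bl_add (mem_part _ fr _) (bl_scale 'i (mem_part _ fi _)).
rewrite (_ : (fun _ => _) = f); last by apply/funext => x; rewrite -complexE.
by apply=> x; apply: le_trans (fN x); case: (f x) => a b /=;
  rewrite -sqrtr_sqr ler_wsqrtr // ?lerDl ?lerDr sqr_ge0.
Qed.

End Lattice.

(** * Calculus of integral operators bounded on [X] *)

Section KernelOperators.
Variables (R : realType) (X : banach_lattice R).
Implicit Types (f g : R -> R[i]) (k : R -> R -> R[i]).

Definition kernel_op k f (x : R) : R[i] := cintegral (fun y => f y * k x y).

(** The bound is asked on bounded measurable inputs only. Regularity of the output is part of the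
    property, in place of a joint measurability condition on [k], and passes through sums and
    modulations. *)
Definition kernel_bounded (B : R) k : Prop :=
  (forall x, bmeas (k x)) /\
  forall f, bmeas f ->
    bmeas (kernel_op k f) /\ bl_norm X (kernel_op k f) <= B * bl_norm X f.

Lemma kernel_bounded_le B B' k : B <= B' -> kernel_bounded B k -> kernel_bounded B' k.
Proof.
move=> BB' [mk kB]; split=> // f mf; have [mkf kf] := kB f mf; split=> //.
by apply: (le_trans kf); rewrite ler_wpM2r // bl_norm_ge0 //; exact: bmeas_mem.
Qed.

Lemma eq_kernel_bounded B k k' : (forall x y, k x y = k' x y) ->
  kernel_bounded B k -> kernel_bounded B k'.
Proof. by move=> kk'; rewrite (_ : k = k') //; do 2 (apply/funext => ?). Qed.

Lemma kernel_op_sum (I : Type) (r : seq I) (F : I -> R -> R -> R[i]) f x :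
  bmeas f -> (forall i, bmeas (F i x)) ->
  kernel_op (fun x y => \sum_(i <- r) F i x y) f x = \sum_(i <- r) kernel_op (F i) f x.
Proof.
move=> mf mF; rewrite /kernel_op.
under [in LHS]eq_fun do rewrite mulr_sumr.
by rewrite cintegral_sum // => i; exact: bmeas_mul.
Qed.

Lemma kernel_bounded_sum (I : Type) (r : seq I) (B : I -> R) (F : I -> R -> R -> R[i]) :
  (forall i, kernel_bounded (B i) (F i)) ->
  kernel_bounded (\sum_(i <- r) B i) (fun x y => \sum_(i <- r) F i x y).
Proof.
move=> FB; split=> [x|f mf]; first by apply: bmeas_sum => i; case: (FB i).
rewrite (_ : kernel_op _ f = fun x => \sum_(i <- r) kernel_op (F i) f x); last first.
  by apply/funext => x; apply: kernel_op_sum => // i; case: (FB i).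
have mF i : bmeas (kernel_op (F i) f) by case: (FB i) => _ /(_ f mf) [].
split; first exact: bmeas_sum.
apply: (le_trans (bl_norm_sum r (fun i => bmeas_mem X (mF i)))).
by rewrite mulr_suml; apply: ler_sum => i _; case: (FB i) => _ /(_ f mf) [].
Qed.

Lemma kernel_boundedD B B' k k' : kernel_bounded B k -> kernel_bounded B' k' ->
  kernel_bounded (B + B') (fun x y => k x y + k' x y).
Proof.
move=> kB kB'; have := @kernel_bounded_sum bool [:: true; false]
  (fun b => if b then B else B') (fun b => if b then k else k').
rewrite !big_cons big_nil addr0.
under eq_fun do under eq_fun do rewrite !big_cons big_nil addr0.
by apply; case.
Qed.

(** The factor [b y] joins the input and [a x] leaves the integral; both have constant modulus, and
    the lattice norm depends on moduli only. Allowing any constant [c] for [a] also covers scalar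
    multiples. *)
Lemma kernel_bounded_mod B k (a b : R -> R[i]) (c : R) : bmeas a -> bmeas b ->
  (forall x, normc (a x) = c) -> (forall x, normc (b x) = 1) -> kernel_bounded B k ->
  kernel_bounded (c * B) (fun x y => a x * b y * k x y).
Proof.
move=> ma mb ac b1 [mk kB]; split=> [x|f mf].
  by do 2 (apply: bmeas_mul => //); exact: bmeas_cst.
have mfb := bmeas_mul mf mb.
have [mkf kf] := kB _ mfb.
rewrite (_ : kernel_op _ f = fun x => a x * kernel_op k (fun y => f y * b y) x); last first.
  apply/funext => x; rewrite /kernel_op -cintegralZ; last exact/bmeas_integrable/bmeas_mul.
  by congr cintegral; apply/funext => y; ring.
have mak := bmeas_mul ma mkf.
split=> //; rewrite -mulrA.
have c0 : 0 <= c by rewrite -(ac 0) normc_ge0.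
apply: (@le_trans _ _ (c * bl_norm X (kernel_op k (fun y => f y * b y)))).
  rewrite -[X in X * _](ger0_norm c0) -normc_real -bl_normZ; last exact: bmeas_mem.
  apply: bl_norm_le_normc; [exact: bmeas_mem|exact/bl_scale/bmeas_mem|].
  by apply: ae_torusW => x _; rewrite !normcM ac normc_real ger0_norm.
rewrite ler_wpM2l // (le_trans kf) // (@bl_norm_eq_normc _ _ _ f) //.
- exact: bmeas_mem.
- exact: bmeas_mem.
- by apply: ae_torusW => x _; rewrite normcM b1 mulr1.
Qed.

Lemma kernel_boundedZ B k (c : R[i]) : kernel_bounded B k ->
  kernel_bounded (normc c * B) (fun x y => c * k x y).
Proof.
move=> kB; have := kernel_bounded_mod (bmeas_cst c) (bmeas_cst 1)
  (fun=> erefl) (fun=> @normc1 R) kB.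
by under eq_fun do under eq_fun do rewrite mulr1.
Qed.

End KernelOperators.

(** * From bounded partial sums to bounded convolutions *)

Section PartialSums.
Variables (R : realType) (X : banach_lattice R) (C : R).
Hypothesis C_gt0 : 0 < C.
Hypothesis partial_sums_bounded : forall (n : nat) (f : R -> R[i]), bl_mem X f ->
  bl_norm X (fourier_sum n f) <= C * bl_norm X f.
Implicit Types (f g : R -> R[i]).

(** The factor [2 pi] appears because convolutions are taken without the normalisation of the
    Fourier coefficients. *)
Let K : R := 2 * pi * C.

Lemma K_ge0 : 0 <= K.
Proof. by rewrite !mulr_ge0 ?pi_ge0 // ltW. Qed.

Lemma dirichlet_expi n (u : R) : dirichlet n (expi u) =
  \sum_(j < (2 * n).+1) expi ((j%:Z - n%:Z)%:~R * u).
Proof.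
by rewrite /dirichlet /geo mulr_suml; apply: eq_bigr => j _; rewrite expi_intB.
Qed.

Lemma measurable_affine (a b : R) : measurable_fun setT (fun y => a * y + b).
Proof.
apply: measurable_funD; last exact: measurable_cst.
by apply: measurable_funM; [exact: measurable_cst|exact: measurable_id].
Qed.

Lemma bmeas_expiM (a : R) : bmeas (fun y : R => expi (a * y)).
Proof.
by have := bmeas_expi (measurable_affine a 0); under eq_fun do rewrite addr0.
Qed.

Lemma bmeas_trig_sum n (c : int -> R[i]) : bmeas (trig_sum n c).
Proof.
apply: bmeas_sum => j; apply: bmeas_mul; first exact: bmeas_cst.
exact: bmeas_expiM.
Qed.

Lemma kernel_op_dirichlet n f : bmeas f ->
  kernel_op (fun x y => dirichlet n (expi (x - y))) f =
  fun x => (2 * pi)%:C * fourier_sum n f x.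
Proof.
move=> mf; apply/funext => x.
have pi0 : (2 * pi : R) != 0 by rewrite mulf_neq0 // gt_eqF // pi_gt0.
under [in LHS]eq_fun do under eq_fun do rewrite dirichlet_expi.
rewrite kernel_op_sum // => [|j]; last first.
  apply: bmeas_expi.
  have := measurable_affine (- (j%:Z - n%:Z)%:~R) ((j%:Z - n%:Z)%:~R * x).
  by congr measurable_fun; apply/funext => y; ring.
rewrite /fourier_sum /trig_sum mulr_sumr; apply: eq_bigr => j _.
rewrite /kernel_op /fourier_coef; set a : R := (j%:Z - n%:Z)%:~R.
rewrite !mulrA -rmorphM divff // mul1r [RHS]mulrC -cintegralZ; last first.
  apply/bmeas_integrable/bmeas_mul => //.
  have := bmeas_expiM (- a); congr bmeas.
  by apply/funext => y; rewrite mulNr.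
congr cintegral; apply/funext => y.
by rewrite mulrCA -expiD; congr (_ * expi _); ring.
Qed.

Lemma kernel_bounded_dirichlet n :
  kernel_bounded X K (fun x y => dirichlet n (expi (x - y))).
Proof.
split=> [x|f mf].
  under eq_fun do rewrite dirichlet_expi.
  apply: bmeas_sum => j; apply: bmeas_expi.
  have := measurable_affine (- (j%:Z - n%:Z)%:~R) ((j%:Z - n%:Z)%:~R * x).
  by congr measurable_fun; apply/funext => y; ring.
have mS : bmeas (fourier_sum n f) := bmeas_trig_sum n _.
rewrite kernel_op_dirichlet //; split.
  by apply: bmeas_mul => //; exact: bmeas_cst.
rewrite bl_normZ ?normc_real; last exact: bmeas_mem.
rewrite ger0_norm ?mulr_ge0 ?pi_ge0 // /K -mulrA.
rewrite ler_wpM2l ?mulr_ge0 ?pi_ge0 //.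
exact/partial_sums_bounded/bmeas_mem.
Qed.

(** The power splits as [e^{ilx} e^{-ily}], a modulation of output and input. *)
Lemma kernel_bounded_modX B k (l : nat) : kernel_bounded X B k ->
  kernel_bounded X B (fun x y => expi (x - y) ^+ l * k x y).
Proof.
have m1 := bmeas_expiM l%:R; have m2 := bmeas_expiM (- l%:R).
move=> /(kernel_bounded_mod m1 m2 (fun=> normc_expi _) (fun=> normc_expi _)).
rewrite mul1r; apply: eq_kernel_bounded => x y.
by rewrite -expi_nat -expiD; congr (expi _ * _); ring.
Qed.

(* A one-sided sum of odd length is a modulated Dirichlet kernel; for even
   length one more modulated copy of [dirichlet 0] is needed. *)
Lemma kernel_bounded_geo m : (0 < m)%N ->
  kernel_bounded X (2 * K) (fun x y => geo m (expi (x - y))).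
Proof.
have geo_odd l (x y : R) : geo (2 * l).+1 (expi (x - y)) =
    expi (x - y) ^+ l * dirichlet l (expi (x - y)).
  by rewrite /dirichlet mulrCA divff ?mulr1 // expf_neq0 // expi_neq0.
have K0 := K_ge0.
have bounded_odd l : kernel_bounded X K (fun x y => geo (2 * l).+1 (expi (x - y))).
  under eq_fun do under eq_fun do rewrite geo_odd.
  exact/kernel_bounded_modX/kernel_bounded_dirichlet.
case: m => // m _; rewrite -(odd_double_half m); case: (odd m) => /=.
  have := kernel_boundedD (bounded_odd m./2)
    (kernel_bounded_modX (2 * m./2).+1 (kernel_bounded_dirichlet 0)).
  rewrite mulrDl mul1r; apply: eq_kernel_bounded => x y.
  by rewrite add1n -mul2n [RHS]geoS dirichlet_expi big_ord1 subrr mul0r expi0 mulr1.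
by rewrite add0n -mul2n; apply: kernel_bounded_le (bounded_odd m./2); lra.
Qed.

Lemma kernel_bounded_sqr m : kernel_bounded X (m%:R * K)
  (fun x y => ((normc (geo m (expi (x - y)))) ^+ 2)%:C).
Proof.
under eq_fun do under eq_fun do rewrite sqr_normc_geo ?normc_expi //.
have := kernel_bounded_sum (index_enum 'I_m)
  (fun l : 'I_m => kernel_bounded_dirichlet l).
by rewrite sumr_const card_ord mulr_natl.
Qed.

(** Each [|G_m|^2] has bound [m K]. Divided by [N^2], the first summand gives [N * N K], hence [K],
    and the [8N] others at most [8N * 8N K], hence [64 K]. *)
Lemma kernel_bounded_majorant N : (0 < N)%N ->
  kernel_bounded X (65 * K) (fun x y => (majorant N (expi (x - y)))%:C).
Proof.
move=> N0; have Np : 0 < N%:R :> R by rewrite ltr0n.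
have K0 := K_ge0.
have nR (a : R) : 0 <= a -> normc a%:C = a by move=> a0; rewrite normc_real ger0_norm.
have := kernel_boundedZ (N%:R ^- 2 : R)%:C (kernel_boundedD
  (kernel_boundedZ (N%:R : R)%:C (kernel_bounded_sqr N))
  (kernel_bounded_sum (index_enum 'I_(8 * N))
    (fun m : 'I_(8 * N) => kernel_bounded_sqr m.+1))).
rewrite !nR ?invr_ge0 ?sqr_ge0 ?ler0n // => kB.
have -> : (fun x y => (majorant N (expi (x - y)))%:C) = (fun x y : R =>
    (N%:R ^- 2 : R)%:C * ((N%:R : R)%:C * (normc (geo N (expi (x - y))) ^+ 2)%:C +
      \sum_(m < 8 * N) (normc (geo m.+1 (expi (x - y))) ^+ 2)%:C)).
  apply/funext => x; apply/funext => y.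
  by rewrite /majorant mulrC rmorphM rmorphD rmorphM rmorph_sum.
apply: kernel_bounded_le kB.
rewrite ler_pdivrMl ?exprn_gt0 //.
have : \sum_(m < 8 * N) m.+1%:R * K <= \sum_(m < 8 * N) 8 * N%:R * K.
  by apply: ler_sum => m _; rewrite ler_wpM2r // -natrM ler_nat.
rewrite sumr_const card_ord -[X in _ <= X]mulr_natr natrM.
nra.
Qed.

Lemma kernel_bounded_cesaro N : (0 < N)%N ->
  kernel_bounded X (2 * K) (fun x y => cesaro_geo N (expi (x - y))).
Proof.
move=> N0; have Np : 0 < N%:R :> R by rewrite ltr0n.
have := kernel_boundedZ (N%:R^-1) (kernel_bounded_sum (index_enum 'I_N)
    (fun m : 'I_N => kernel_bounded_geo (ltn0Sn m))).
apply: kernel_bounded_le.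
rewrite sumr_const card_ord normcV -[N%:R](rmorph_nat (real_complex R)) normc_real.
by rewrite ger0_norm // -[X in _ * X]mulr_natl mulKf // gt_eqF.
Qed.

End PartialSums.

(** * Equispaced nodes, their cells, and interpolation *)

Section Nodes.
Variables (R : realType) (n : nat).
Let N := (2 * n).+1.
Implicit Types (c : nat -> R[i]) (x y : R).

(** Half-open, so that the [N] cells partition the torus; the closed intervals of [step_abs] share
    endpoints. *)
Definition cell (k : nat) : set R := `[node R n k, node R n k.+1[%classic.

Definition step c y : R[i] := \sum_(k < (2 * n).+1) c k * cindic (cell k) y.

Let NE : (2 * n + 1)%N = N. Proof. by rewrite addn1. Qed.

Lemma nodeS k : node R n k.+1 = node R n k + 2 * pi / N%:R.
Proof. by rewrite /node NE -natr1; ring. Qed.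

Lemma bmeas_cell k : bmeas (cindic (cell k)).
Proof. by apply: bmeas_indic; exact: measurable_itv. Qed.

Lemma bmeas_step c : bmeas (step c).
Proof.
by apply: bmeas_sum => k; apply: bmeas_mul; [exact: bmeas_cst|exact: bmeas_cell].
Qed.

(** The index is the integer part of [y N / (2 pi)]. Since [c] is quantified after [k], one choice
    of cell evaluates several step functions at [y]. *)
Lemma cellP y : torus R y -> exists k : 'I_N,
  [/\ node R n k <= y, y < node R n k.+1 & forall c, step c y = c k].
Proof.
rewrite /torus /= in_itv /= => /andP[y0 y2].
have Np : 0 < N%:R :> R by rewrite ltr0n.
have p2 : 0 < 2 * pi :> R by rewrite mulr_gt0 ?pi_gt0.
pose t := y * N%:R / (2 * pi); have t0 : 0 <= t by rewrite !mulr_ge0 ?invr_ge0 // ltW.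
have node_le k : (node R n k <= y) = (k%:R <= t).
  by rewrite /node NE ler_pdivrMr // ler_pdivlMr // mulrC.
have cellE k : cindic (cell k) y = (k == Num.truncn t)%:R.
  have -> : (k == Num.truncn t) = (k%:R <= t < k.+1%:R).
    by rewrite eq_sym truncn_eq.
  rewrite /cindic indicE -[RHS](rmorph_nat (real_complex R)); congr (nat_of_bool _)%:R%:C.
  rewrite -node_le ltNge -node_le -ltNge; apply/idP/idP => [/set_mem|H].
    by rewrite /cell /= in_itv.
  by apply/mem_set; rewrite /cell /= in_itv.
have kN : (Num.truncn t < N)%N.
  have : t < N%:R by rewrite ltr_pdivrMr // mulrC ltr_pM2l.
  rewrite -(ltr_nat R); apply: le_lt_trans.
  by rewrite truncn_le.
exists (Ordinal kN); have /andP[h1 h2] := truncn_itv t0.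
split; [by rewrite node_le|by rewrite ltNge node_le -ltNge|].
move=> c; rewrite /step (bigD1 (Ordinal kN)) //= cellE eqxx mulr1 big1 ?addr0 // => i ik.
by rewrite cellE; move: ik; rewrite -val_eqE /= => /negPf ->; rewrite mulr0.
Qed.

Lemma cintegral_step c : cintegral (step c) = (2 * pi / N%:R)%:C * \sum_(k < N) c k.
Proof.
have mI := bmeas_cell.
rewrite /step cintegral_sum => [|k]; last by apply: bmeas_mul => //; exact: bmeas_cst.
rewrite mulr_sumr; apply: eq_bigr => k _.
rewrite cintegralZ; last exact: bmeas_integrable.
have Np : 0 < N%:R :> R by rewrite ltr0n.
have p2 : 0 <= 2 * pi :> R by rewrite mulr_ge0 ?pi_ge0.
rewrite cintegral_indic; first by rewrite mulrC nodeS; congr (_%:C * _); ring.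
- by rewrite /node !mulr_ge0 ?pi_ge0 ?invr_ge0 ?ler0n.
- by rewrite nodeS lerDl divr_ge0.
- by rewrite /node NE ler_pdivrMr // ler_wpM2l // ler_nat ltn_ord.
Qed.

(** A cell has length [2 pi / N] and [expi] has Lipschitz constant 2, which gives [4 pi <= 16], the
    closeness assumed by the kernel estimates. *)
Lemma node_shift k x y : node R n k <= x -> x < node R n k.+1 ->
  N%:R * normc (expi (x - y) - expi (node R n k - y)) <= 16.
Proof.
rewrite nodeS => h1 h2; have Np : 0 < N%:R :> R by rewrite ltr0n.
have : normc (expi (x - y) - expi (node R n k - y)) <= 2 * (2 * pi / N%:R).
  apply: (le_trans (expi_lip _ _)); rewrite ler_pM2l //.
  by rewrite opprB addrA subrK ger0_norm; lra.
rewrite -(ler_pM2l Np) => /le_trans; apply.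
have -> : N%:R * (2 * (2 * pi / N%:R)) = 8 * (pi / 2 : R) by field; rewrite gt_eqF.
by have := @pihalf_lt2 R; lra.
Qed.

Lemma node_shiftr k x y : node R n k <= y -> y < node R n k.+1 ->
  N%:R * normc (expi (x - y) - expi (x - node R n k)) <= 16.
Proof.
rewrite nodeS => h1 h2; have Np : 0 < N%:R :> R by rewrite ltr0n.
have : normc (expi (x - y) - expi (x - node R n k)) <= 2 * (2 * pi / N%:R).
  apply: (le_trans (expi_lip _ _)); rewrite ler_pM2l //.
  have -> : x - y - (x - node R n k) = node R n k - y by ring.
  by rewrite distrC ger0_norm; lra.
rewrite -(ler_pM2l Np) => /le_trans; apply.
have -> : N%:R * (2 * (2 * pi / N%:R)) = 8 * (pi / 2 : R) by field; rewrite gt_eqF.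
by have := @pihalf_lt2 R; lra.
Qed.

Lemma sum_roots (w : R[i]) : w ^+ N = 1 -> w != 1 -> \sum_(k < N) w ^+ k = 0.
Proof.
move=> wN w1; apply: (mulfI (_ : w - 1 != 0)); first by rewrite subr_eq0.
by rewrite -subrX1 wN subrr mulr0.
Qed.

(** Discrete orthogonality: the points [e^{i t_k}] are the powers of a primitive [N]-th root of
    unity [rho], and for distinct [i, j < N] the ratio [rho^i / rho^j] is an [N]-th root of unity
    other than 1. *)
Lemma expi_node_sum (i j : nat) : (i < N)%N -> (j < N)%N ->
  \sum_(k < N) expi (node R n k) ^+ i / expi (node R n k) ^+ j =
  if i == j then N%:R else 0.
Proof.
move=> iN jN; have Np : 0 < N%:R :> R by rewrite ltr0n.
pose rho : R[i] := expi (2 * pi / N%:R).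
have nodeE k : expi (node R n k) = rho ^+ k.
  by rewrite -expi_nat /node NE; congr expi; ring.
have rhoN : rho ^+ N = 1.
  by rewrite -expi_nat -[RHS](expi_2pi R); congr expi; field; rewrite gt_eqF.
have rho0 : rho != 0 by exact: expi_neq0.
have termE k : expi (node R n k) ^+ i / expi (node R n k) ^+ j = (rho ^+ i / rho ^+ j) ^+ k.
  by rewrite nodeE exprMn exprVn -!exprM ![(k * _)%N]mulnC.
under eq_bigr do rewrite termE.
case: eqVneq => [<-|ij].
  under eq_bigr do rewrite divff ?expf_neq0 // expr1n.
  by rewrite sumr_const card_ord.
apply: sum_roots.
  by rewrite exprMn exprVn -!exprM ![(_ * N)%N]mulnC !exprM rhoN !expr1n invr1 mulr1.
have rho1 m : (0 < m)%N -> (m < N)%N -> rho ^+ m != 1.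
  move=> m0 mN; rewrite -expi_nat; apply: expi_nontrivial.
  have m0' : 0 < m%:R :> R by rewrite ltr0n.
  have p2 : 0 < 2 * pi :> R by rewrite mulr_gt0 ?pi_gt0.
  rewrite mulrA divr_gt0 ?mulr_gt0 ?pi_gt0 //= ltr_pdivrMr // mulrC ltr_pM2l //.
  by rewrite ltr_nat.
have [lt|gt|eq] := ltngtP i j; last by rewrite eq eqxx in ij.
  rewrite -(subnK (ltnW lt)) exprD invfM mulrCA divff ?expf_neq0 // mulr1 invr_eq1.
  by rewrite rho1 ?subn_gt0 // (leq_ltn_trans (leq_subr _ _)).
rewrite -(subnK (ltnW gt)) exprD mulfK ?expf_neq0 //.
by rewrite rho1 ?subn_gt0 // (leq_ltn_trans (leq_subr _ _)).
Qed.

(** Expanding both factors and summing over the nodes first leaves only the diagonal: the [2n+1]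
    frequencies of [T] and of the kernel are distinct modulo [N]. *)
Lemma trig_interpolation (T : R -> R[i]) x : trig_poly n T ->
  \sum_(k < N) T (node R n k) * dirichlet n (expi (x - node R n k)) = N%:R * T x.
Proof.
move=> [c TE]; rewrite TE /trig_sum mulr_sumr.
under eq_bigr => k _.
  rewrite TE /trig_sum dirichlet_expi mulr_suml.
  under eq_bigr => j _.
    rewrite mulr_sumr.
    under eq_bigr => i _.
      rewrite (_ : _ * _ = c (j%:Z - n%:Z) * (expi ((i%:Z - n%:Z)%:~R * x) *
        (expi (node R n k) ^+ j / expi (node R n k) ^+ i))); last first.
        rewrite mulrBr expiD expiN !expi_intB -/(node R n k).
        have := expi_neq0 (node R n k); have := expi_neq0 x.
        move: (expi x) (expi _) => p q p0 q0.
        by field; rewrite !expf_neq0.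
      over.
    over.
  over.
rewrite exchange_big /=; apply: eq_bigr => j _.
rewrite exchange_big /= (bigD1 j) //= -!mulr_sumr expi_node_sum ?ltn_ord // eqxx.
rewrite big1 ?addr0; first by ring.
move=> i ij; rewrite -!mulr_sumr expi_node_sum ?ltn_ord //.
by rewrite eq_sym -[X in if X then _ else _]/(i == j) (negPf ij) !mulr0.
Qed.

End Nodes.

(** * Kernels that reproduce trigonometric polynomials *)

Section Reproduction.
Variable R : realType.

Lemma bmeas_trig_poly (n : nat) (T : R -> R[i]) : trig_poly n T -> bmeas T.
Proof.
move=> [c TE]; rewrite (_ : T = trig_sum n c); first exact: bmeas_trig_sum.
exact: funext.
Qed.

Lemma dirichlet_reproduces (n l : nat) (T : R -> R[i]) x : trig_poly n T -> (n <= l)%N ->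
  kernel_op (fun x y => dirichlet l (expi (x - y))) T x = (2 * pi)%:C * T x.
Proof.
move=> [c TE] nl.
have p2 : 0 < 2 * pi :> R by rewrite mulr_gt0 ?pi_gt0.
(* The frequency [(j - n) - (i - l)] of the product in [y], regrouped as a difference of natural
   numbers; it vanishes exactly for [i = j + (l - n)]. *)
pose a (i j : nat) : R := ((j + l)%N%:Z - (i + n)%N%:Z)%:~R.
have -> : kernel_op (fun x y => dirichlet l (expi (x - y))) T x =
   cintegral (fun y => \sum_(j < (2 * n).+1) \sum_(i < (2 * l).+1)
     (c (j%:Z - n%:Z) * expi ((i%:Z - l%:Z)%:~R * x)) * expi (a i j * y)).
  congr cintegral; apply/funext => y; rewrite TE /trig_sum mulr_suml.
  apply: eq_bigr => j _; rewrite dirichlet_expi mulr_sumr; apply: eq_bigr => i _.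
  rewrite mulrBr !expiD expiN /a !expi_intB !exprD.
  have := expi_neq0 y; have := expi_neq0 x; move: (expi x) (expi y) => p q p0 q0.
  by field; rewrite !expf_neq0.
have mE i j : bmeas (fun y => (c (j%:Z - n%:Z) * expi ((i%:Z - l%:Z)%:~R * x)) *
    expi (a i j * y)).
  by apply: bmeas_mul; [exact: bmeas_cst|exact: bmeas_expiM].
rewrite cintegral_sum => [|j]; last exact: bmeas_sum.
rewrite TE /trig_sum mulr_sumr; apply: eq_bigr => j _.
rewrite cintegral_sum => [|i]; last exact: mE.
have intE i : cintegral (fun y => expi (a i j * y)) =
    if (i == j + (l - n))%N then (2 * pi)%:C else 0.
  case: eqP => [->|ij].
    rewrite (_ : a _ _ = 0); last first.
      by rewrite /a -addnA subnK // subrr.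
    under eq_fun do rewrite mul0r expi0.
    rewrite (@eq_cintegral _ _ (cindic `[0, 2 * pi[%classic)).
      by rewrite cintegral_indic ?subr0 // ltW.
    by move=> y Ty; rewrite /cindic indicE Ty.
  apply: cintegral_expi.
    rewrite /a intr_eq0 subr_eq0; apply/eqP => -[] H; apply: ij.
    by apply/(@addIn n); rewrite -addnA subnK.
  by rewrite /a expi_intB expi_2pi !expr1n divr1.
have jl : (j + (l - n) < (2 * l).+1)%N.
  have := ltn_ord j; lia.
rewrite (bigD1 (Ordinal jl)) //= big1 ?addr0 => [|i ij].
  rewrite cintegralZ; last exact/bmeas_integrable/bmeas_expiM.
  rewrite intE eqxx mulrC; congr (_ * (_ * expi (_%:~R * _))).
  by rewrite PoszD -subzn //; ring.
rewrite cintegralZ; last exact/bmeas_integrable/bmeas_expiM.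
by rewrite intE; move: ij; rewrite -val_eqE /= => /negPf ->; rewrite mulr0.
Qed.

(** The difference of the two Fejer sums is the sum of [D_l] over [N <= l < 2N]: [N] kernels of
    degree at least [n], each reproducing [T] with factor [2 pi]. *)
Lemma vallee_poussin_reproduces (n N : nat) (T : R -> R[i]) x : trig_poly n T ->
  (n <= N)%N ->
  cintegral (fun y => T y * (normc (geo (2 * N) (expi (x - y))) ^+ 2 -
    normc (geo N (expi (x - y))) ^+ 2)%:C) = N%:R * (2 * pi)%:C * T x.
Proof.
move=> hT nN.
have mT := bmeas_trig_poly hT.
have mD l (y : R) : bmeas (fun z => dirichlet l (expi (y - z))).
  under eq_fun do rewrite dirichlet_expi.
  apply: bmeas_sum => j; apply: bmeas_expi.
  have := measurable_affine (- (j%:Z - l%:Z)%:~R) ((j%:Z - l%:Z)%:~R * y).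
  by congr measurable_fun; apply/funext => z; ring.
transitivity (kernel_op (fun x y => \sum_(l < N) dirichlet (N + l) (expi (x - y))) T x).
  congr cintegral; apply/funext => y; congr (_ * _).
  rewrite real_complexB !sqr_normc_geo ?normc_expi // mul2n -addnn big_split_ord /=.
  by rewrite addrAC subrr add0r.
rewrite kernel_op_sum //.
under eq_bigr => l _ do rewrite (dirichlet_reproduces x hT (leq_trans nN (leq_addr _ _))).
by rewrite sumr_const card_ord -[LHS]mulr_natl mulrA.
Qed.

End Reproduction.

(** * The two inequalities between a polynomial and its samples *)

Section Sampling.
Variables (R : realType) (X : banach_lattice R) (C : R).
Hypothesis C_gt0 : 0 < C.
Hypothesis partial_sums_bounded : forall (n : nat) (f : R -> R[i]), bl_mem X f ->
  bl_norm X (fourier_sum n f) <= C * bl_norm X f.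
Variables (n : nat) (T : R -> R[i]).
Hypothesis trigT : trig_poly n T.

Let N := (2 * n).+1.
Let t (k : nat) : R := node R n k.
Let K : R := 2 * pi * C.
Let samples : R -> R[i] := step n (fun k => T (t k)).
Let Np : 0 < N%:R :> R. Proof. by rewrite ltr0n. Qed.
Let mT : bmeas T := bmeas_trig_poly trigT.
Let pi2 : 0 < 2 * pi :> R. Proof. by rewrite mulr_gt0 ?pi_gt0. Qed.

Let maj_op (f : R -> R[i]) : R -> R[i] :=
  kernel_op (fun x y => (majorant N (expi (x - y)))%:C) (fun y => (normc (f y))%:C).

Lemma bmeas_majorant x : bmeas (fun y : R => (majorant N (expi (x - y)))%:C).
Proof. by case: (kernel_bounded_majorant C_gt0 partial_sums_bounded (ltn0Sn (2 * n))). Qed.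

Lemma maj_opP f : bmeas f ->
  bmeas (maj_op f) /\ bl_norm X (maj_op f) <= 65 * K * bl_norm X f.
Proof.
move=> mf; have mnf := bmeas_normc mf.
have [_ /(_ _ mnf) [mo ho]] :=
  kernel_bounded_majorant C_gt0 partial_sums_bounded (ltn0Sn (2 * n)).
split=> //; rewrite (@bl_norm_eq_normc _ _ f (fun y => (normc (f y))%:C)) //.
- exact: bmeas_mem.
- exact: bmeas_mem.
- by apply: ae_torusW => x _; rewrite normc_real ger0_norm ?normc_ge0.
Qed.

(** Only the bound on [h] refers to [x], so [h] may be the integrand of a convolution evaluated at
    another point, such as the node of the cell of [x]. *)
Lemma maj_op_dominates f (h : R -> R[i]) (a x : R) : 0 <= a -> bmeas f -> bmeas h ->
  (forall y, torus R y ->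
    normc (h y) <= a * (normc (f y) * majorant N (expi (x - y)))) ->
  normc (cintegral h) <= a * normc (maj_op f x).
Proof.
move=> a0 mf mh hf; have mnf := bmeas_normc mf.
have mg := bmeas_mul (bmeas_cst a%:C) (bmeas_mul mnf (bmeas_majorant x)).
apply: (@le_trans _ _ (complex.Re (cintegral (fun y =>
    a%:C * ((normc (f y))%:C * (majorant N (expi (x - y)))%:C))))).
  apply: normc_cintegral_le; [exact: bmeas_integrable|exact: bmeas_integrable|].
  by move=> y Ty; rewrite -!rmorphM; exact: hf.
rewrite cintegralZ; last exact/bmeas_integrable/bmeas_mul/bmeas_majorant.
apply: (le_trans (Re_le_normc _)).
by rewrite normcM normc_real ger0_norm.
Qed.

(** Closed and half-open cells differ only at nodes, a null set; away from them the two step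
    functions have equal modulus. *)
Lemma step_abs_norm : bl_norm X (step_abs n T) = bl_norm X samples.
Proof.
apply: bl_norm_eq_normc.
- apply/bmeas_mem/bmeas_sum => k; apply: bmeas_mul; first exact: bmeas_cst.
  by apply: bmeas_indic; exact: measurable_itv.
- exact/bmeas_mem/bmeas_step.
have off_nodes k : {ae @lebesgue_measure R, forall x, x <> t k}.
  exists [set t k]; split=> //; first exact: lebesgue_measure_set1.
  by move=> x /= /contrapT ->.
have := @ae_foralln _ _ _ (@lebesgue_measure R) _ off_nodes.
apply: (@filterS _ _ (ae_filter_ringOfSetsType (@lebesgue_measure R))) => x xt Tx.
have -> : step_abs n T x = step n (fun k => `|T (t k)|) x.
  apply: eq_bigr => k _; congr (_ * _); rewrite /cindic !indicE.
  congr (nat_of_bool _)%:R%:C; apply/idP/idP => /set_mem H; apply/mem_set.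
    move: H; rewrite /cell /= !in_itv /= => /andP[-> h]; rewrite lt_neqAle h andbT.
    exact/eqP/xt.
  by move: H; rewrite /cell /= !in_itv /= => /andP[-> /ltW].
have [k [_ _ stepE]] := cellP n Tx.
by rewrite /samples !stepE normr_normc normc_real ger0_norm ?normc_ge0.
Qed.

Lemma samples_le : bl_norm X samples <= 3000 * 65 * C * bl_norm X T.
Proof.
have [mo ho] := maj_opP mT.
have key : bl_norm X (fun x => (2 * pi : R)%:C * samples x) <=
    bl_norm X (fun x => (3000 : R)%:C * maj_op T x).
  apply: bl_norm_le_normc; [exact/bl_scale/bmeas_mem/bmeas_step
    |exact/bl_scale/bmeas_mem|].
  apply: ae_torusW => x Tx; have [k [h1 h2 stepE]] := cellP n Tx.
  rewrite /samples stepE !normcM !normc_real !ger0_norm ?ler0n ?(ltW pi2) //.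
  have rep := vallee_poussin_reproduces (N := N) (t k) trigT.
  have nN : (n <= N)%N by rewrite /N; lia.
  have nNC : normc (N%:R : R[i]) = N%:R.
    by rewrite -[N%:R](rmorph_nat (real_complex R)) normc_real ger0_norm.
  (* Both sides are multiplied by [N] to match the factor in the reproduction formula. The kernel is
     centred at [t k] and the majorant at [x], which [node_shift] allows. *)
  rewrite -(ler_pM2l Np) [X in X <= _]mulrA.
  have <- : normc (N%:R * (2 * pi)%:C * T (t k)) = N%:R * (2 * pi) * normc (T (t k)).
    by rewrite !normcM nNC normc_real ger0_norm // ltW.
  rewrite -(rep nN) [X in _ <= X]mulrA; apply: maj_op_dominates; [|exact: mT| |].
  - by rewrite mulr_ge0 ?ler0n.
  - apply: bmeas_mul => //.
    have mg m : bmeas (fun y => (normc (geo m (expi (t k - y))) ^+ 2)%:C).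
      by case: (kernel_bounded_sqr partial_sums_bounded m).
    under eq_fun do rewrite real_complexB.
    by apply: bmeas_add => //; exact: bmeas_opp.
  move=> y _; rewrite normcM normc_real.
  have := vallee_poussin_le (ltn0Sn (2 * n)) (normc_expi (x - y)) (normc_expi (t k - y))
    (node_shift y h1 h2).
  by move/(ler_wpM2l (normc_ge0 (T y))) => /le_trans; apply; rewrite -/N; lra.
move: key; rewrite !bl_normZ; [|exact/bmeas_mem|exact/bmeas_mem/bmeas_step].
rewrite !normc_real !ger0_norm ?ler0n ?(ltW pi2) // => key.
rewrite -(ler_pM2l pi2); apply: (le_trans key).
rewrite /K in ho; nra.
Qed.

(** The unimodular weights [a k] will carry the [t_k] part of the numerators [s^{n+1}] and
    [s^{-n}]. *)
Let lift (a : nat -> R[i]) : R -> R[i] := step n (fun k => T (t k) * a k).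

Let lift_norm (a : nat -> R[i]) : (forall k, normc (a k) = 1) ->
  bl_norm X (lift a) = bl_norm X samples.
Proof.
move=> a1; apply: bl_norm_eq_normc; [exact/bmeas_mem/bmeas_step|exact/bmeas_mem/bmeas_step|].
apply: ae_torusW => x Tx; have [k [_ _ stepE]] := cellP n Tx.
by rewrite /lift /samples !stepE normcM a1 mulr1.
Qed.

(** In the constant, [304 * 65] is the error term, dominated by the majorant, and [4 = 2 + 2] comes
    from the two Cesaro convolutions. *)
Lemma le_samples : bl_norm X T <= (304 * 65 + 4) * C * bl_norm X samples.
Proof.
have ms : bmeas samples by exact: bmeas_step.
have [mo ho] := maj_opP ms.
pose Q (x y : R) := cesaro_geo N (expi (x - y)).
have [mQ bQ] : kernel_bounded X (2 * K) Q.
  exact: kernel_bounded_cesaro (ltn0Sn (2 * n)).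
pose a1 k := expi (- (n.+1%:R * t k)); pose a2 k := expi (n%:R * t k).
have ml a : bmeas (lift a) by exact: bmeas_step.
have [mg1 bg1] := bQ _ (ml a1); have [mg2 bg2] := bQ _ (ml a2).
rewrite !lift_norm in bg1 bg2; try by move=> k; exact: normc_expi.
set u1 := kernel_op Q (lift a1) in mg1 bg1.
set u2 := kernel_op Q (lift a2) in mg2 bg2.
have pt x : normc ((2 * pi)%:C * T x) <=
    304 * normc (maj_op samples x) + normc (u1 x) + normc (u2 x).
  pose e1 := expi (n.+1%:R * x); pose e2 := expi (- (n%:R * x)).
  pose G := step n (fun k => T (t k) * dirichlet n (expi (x - t k))).
  have intG : cintegral G = (2 * pi)%:C * T x.
    rewrite cintegral_step (trig_interpolation x trigT) mulrA; congr (_ * _).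
    have -> : N%:R = (N%:R : R)%:C by rewrite rmorph_nat.
    by rewrite -rmorphM /= divfK // gt_eqF.
  (* On the cell of [t_k], [E] is [T (t k)] times the difference estimated in [dirichlet_cesaro_le].
     Its integral is [2 pi T(x)] plus two modulated Cesaro convolutions of lifted samples. *)
  pose E y := G y + (e1 * (lift a1 y * Q x y) + (- e2) * (lift a2 y * Q x y)).
  have m1 : bmeas (fun y => lift a1 y * Q x y) by exact: bmeas_mul.
  have m2 : bmeas (fun y => lift a2 y * Q x y) by exact: bmeas_mul.
  have mG : bmeas G by exact: bmeas_step.
  have m1' : bmeas (fun y => e1 * (lift a1 y * Q x y)).
    by apply: bmeas_mul => //; exact: bmeas_cst.
  have m2' : bmeas (fun y => (- e2) * (lift a2 y * Q x y)).
    by apply: bmeas_mul => //; exact: bmeas_cst.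
  have intE : cintegral E = (2 * pi)%:C * T x + (e1 * u1 x + (- e2) * u2 x).
    rewrite cintegral_add; [|exact: bmeas_integrable|exact/bmeas_integrable/bmeas_add].
    rewrite intG cintegral_add; try exact: bmeas_integrable.
    by rewrite !cintegralZ //; exact: bmeas_integrable.
  have -> : (2 * pi)%:C * T x = cintegral E - (e1 * u1 x + (- e2) * u2 x).
    by rewrite intE addrK.
  apply: (le_trans (le_normcB _ _)); rewrite -addrA; apply: lerD; last first.
    apply: (le_trans (le_normcD _ _)).
    by rewrite !normcM normcN !normc_expi !mul1r.
  apply: maj_op_dominates; [exact: ler0n|exact: ms| |].
    by apply: bmeas_add => //; exact: bmeas_add.
  move=> y Ty; have [k [h1 h2 stepE]] := cellP n Ty.
  have := dirichlet_cesaro_le (esym (addn1 (2 * n))) (normc_expi (x - y))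
    (normc_expi (x - t k)) (node_shiftr x h1 h2).
  move/(ler_wpM2l (normc_ge0 (T (t k)))); rewrite -normcM /samples /E /G /lift !stepE.
  rewrite -/N -/(Q x y).
  have -> : T (t k) * dirichlet n (expi (x - t k)) +
      (e1 * (T (t k) * a1 k * Q x y) + - e2 * (T (t k) * a2 k * Q x y)) =
    T (t k) * (dirichlet n (expi (x - t k)) +
      (expi (x - t k) ^+ n.+1 - expi (x - t k) ^- n) * Q x y).
    have -> : expi (x - t k) ^+ n.+1 = e1 * a1 k.
      by rewrite -expi_nat -expiD; congr expi; ring.
    have -> : expi (x - t k) ^- n = e2 * a2 k.
      by rewrite -expi_nat -expiN -expiD; congr expi; ring.
    by ring.
  by move=> /le_trans; apply; lra.
have key : 2 * pi * bl_norm X T <= 304 * (65 * K * bl_norm X samples) +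
    2 * K * bl_norm X samples + 2 * K * bl_norm X samples.
  have -> : 2 * pi * bl_norm X T = bl_norm X (fun x => (2 * pi)%:C * T x).
    by rewrite bl_normZ ?normc_real ?ger0_norm ?(ltW pi2) //; exact: bmeas_mem.
  pose v1 x : R[i] := (304 : R)%:C * (normc (maj_op samples x))%:C.
  pose v2 x : R[i] := (normc (u1 x))%:C; pose v3 x : R[i] := (normc (u2 x))%:C.
  have mv2 : bmeas v2 by exact: bmeas_normc.
  have mv3 : bmeas v3 by exact: bmeas_normc.
  have mv1' : bmeas (fun x => (normc (maj_op samples x))%:C) by exact: bmeas_normc.
  have mv1 : bmeas v1 by apply: bmeas_mul => //; exact: bmeas_cst.
  have nn (u : R -> R[i]) : bmeas u -> bl_norm X (fun x => (normc (u x))%:C) = bl_norm X u.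
    move=> mu; apply: bl_norm_eq_normc; [exact/bmeas_mem/bmeas_normc|exact: bmeas_mem|].
    by apply: ae_torusW => x _; rewrite normc_real ger0_norm ?normc_ge0.
  apply: (@le_trans _ _ (bl_norm X (fun x => (v1 x + v2 x) + v3 x))).
    apply: bl_norm_le_normc.
    - by apply: bl_scale; exact: bmeas_mem.
    - by apply: bmeas_mem; apply: bmeas_add => //; exact: bmeas_add.
    apply: ae_torusW => x _; apply: (le_trans (pt x)).
    by rewrite /v1 /v2 /v3 -rmorphM -!rmorphD normc_real ler_norm.
  apply: (le_trans (bl_normD (bmeas_mem X (bmeas_add mv1 mv2)) (bmeas_mem X mv3))).
  apply: lerD; last by rewrite nn.
  apply: (le_trans (bl_normD (bmeas_mem X mv1) (bmeas_mem X mv2))).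
  apply: lerD; last by rewrite nn.
  rewrite bl_normZ; last exact: bmeas_mem.
  by rewrite nn // normc_real ger0_norm ?ler0n // ler_wpM2l ?ler0n.
rewrite -(ler_pM2l pi2); apply: (le_trans key).
have s0 : 0 <= 2 * pi * (C * bl_norm X samples).
  by rewrite !mulr_ge0 ?pi_ge0 ?(ltW C_gt0) ?bl_norm_ge0 //; exact: bmeas_mem.
rewrite /K; lra.
Qed.

End Sampling.

Theorem theorem4p1 (R : realType) (X : banach_lattice R)
  (hS : exists2 C : R, 0 < C & forall (n : nat) (f : R -> R[i]), bl_mem X f ->
     bl_norm X (fourier_sum n f) <= C * bl_norm X f) :
  exists2 C' : R, 0 < C' & forall (n : nat) (T : R -> R[i]), trig_poly n T ->
    C'^-1 * bl_norm X (step_abs n T) <= bl_norm X T /\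
    bl_norm X T <= C' * bl_norm X (step_abs n T).
Proof.
have [C C0 hC] := hS; have C'0 : 0 < 3000 * 65 * C by lra.
(* The constant of [samples_le] serves both directions, as it exceeds [(304 * 65 + 4) * C]. *)
exists (3000 * 65 * C) => [|n T hT]; first exact: C'0.
rewrite !(step_abs_norm X); split.
  by rewrite ler_pdivrMl; [exact: samples_le|exact: C'0].
apply: (le_trans (le_samples C0 hC hT)); apply: ler_wpM2r.
  exact/bl_norm_ge0/bmeas_mem/bmeas_step.
by lra.
Qed.
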